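(* The $SU(2)$ nonlinear Fourier series, defined on finitely supported sequences, extends to a real analytic map from $\ell^1(\mathbb Z)$ to $A(\mathbb T,\mathbb C^2)$. Moreover, let $R\ge0$ and $F,F'\in\ell^1(\mathbb Z)$ with $\|F\|_{\ell^1},\|F'\|_{\ell^1}\le R$, and let $b,b'$ be the second entries of the nonlinear Fourier series of $F$ and $F'$ respectively. Then $$\|b-b'\|_A\le e^R\|F-F'\|_{\ell^1},$$ and if additionally $R\le0.36$, then $$\|F-F'\|_{\ell^1}\le 2\|b-b'\|_A.$$
   Context: $\mathbb T=\{z\in\mathbb C:|z|=1\}$. For a finitely supported $F:\mathbb Z\to\mathbb C$, its $SU(2)$ nonlinear Fourier series is the pair $(a,b)$ of functions on $\mathbb T$ given by the first row of the ordered product $\prod_k(1+|F_k|^2)^{-1/2}\begin{pmatrix}1&F_kz^k\\-\overline{F_k}z^{-k}&1\end{pmatrix}$ ($k$ increasing from left to right). The Wiener algebra $A(\mathbb T)$ is the space of functions $\sum_n c_nz^n$ on $\mathbb T$ with $(c_n)\in\ell^1(\mathbb Z)$, with norm $\|\sum c_nz^n\|_A=\sum|c_n|$. $A(\mathbb T,\mathbb C^2)$ is the space of pairs $(a,b)$ with $a,b\in A(\mathbb T)$ and norm $\|a\|_A+\|b\|_A$. *)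

(* Defs.v *)
From Stdlib Require Import Reals ZArith.
From Coquelicot Require Import Coquelicot.
Open Scope R_scope.

Definition seqZ := Z -> C.

Definition zpow (z : C) (k : Z) : C :=
  match k with
  | Z0 => RtoC 1
  | Zpos p => Cpow z (Pos.to_nat p)
  | Zneg p => Cpow (Cinv z) (Pos.to_nat p)
  end.

Definition l1 (F : seqZ) : Prop :=
  ex_series (fun n : nat => Cmod (F (Z.of_nat n)) + Cmod (F (- Z.of_nat n - 1)%Z)).
Definition l1_norm (F : seqZ) : R :=
  Series (fun n : nat => Cmod (F (Z.of_nat n)) + Cmod (F (- Z.of_nat n - 1)%Z)).

Definition finitely_supported_in (F : seqZ) (N : nat) : Prop :=
  forall k : Z, (Z.abs k > Z.of_nat N)%Z -> F k = RtoC 0.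

(** Vector operations on sequences (real scalars: ℓ^1 viewed as a real Banach space). *)
Definition sadd (F G : seqZ) : seqZ := fun k => Cplus (F k) (G k).
Definition ssub (F G : seqZ) : seqZ := fun k => Cminus (F k) (G k).
Definition sscal (a : R) (F : seqZ) : seqZ := fun k => Cmult (RtoC a) (F k).

(** Pairs of sequences = coefficient sequences of elements of A(T, C^2). *)
Definition pseq := (seqZ * seqZ)%type.
Definition padd (p q : pseq) : pseq := (sadd (fst p) (fst q), sadd (snd p) (snd q)).
Definition psub (p q : pseq) : pseq := (ssub (fst p) (fst q), ssub (snd p) (snd q)).
Definition pscal (a : R) (p : pseq) : pseq := (sscal a (fst p), sscal a (snd p)).
Definition pzero : pseq := (fun _ => RtoC 0, fun _ => RtoC 0).
Definition pl1 (p : pseq) : Prop := l1 (fst p) /\ l1 (snd p).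
(** norm of A(T,C^2): ||a||_A + ||b||_A, with ||.||_A the ℓ^1 norm of Fourier coefficients *)
Definition pnorm (p : pseq) : R := l1_norm (fst p) + l1_norm (snd p).

Definition Zseries_to (c : seqZ) (z : C) (v : C) : Prop :=
  exists v1 v2 : C,
    is_series (fun n : nat => Cmult (c (Z.of_nat n)) (zpow z (Z.of_nat n))) v1 /\
    is_series (fun n : nat => Cmult (c (- Z.of_nat n - 1)%Z) (zpow z (- Z.of_nat n - 1)%Z)) v2 /\
    v = Cplus v1 v2.

Record mat2 := Mat2 { m11 : C; m12 : C; m21 : C; m22 : C }.
Definition mmul (A B : mat2) : mat2 :=
  Mat2 (Cplus (Cmult (m11 A) (m11 B)) (Cmult (m12 A) (m21 B)))
       (Cplus (Cmult (m11 A) (m12 B)) (Cmult (m12 A) (m22 B)))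
       (Cplus (Cmult (m21 A) (m11 B)) (Cmult (m22 A) (m21 B)))
       (Cplus (Cmult (m21 A) (m12 B)) (Cmult (m22 A) (m22 B))).
Definition mid : mat2 := Mat2 (RtoC 1) (RtoC 0) (RtoC 0) (RtoC 1).

Definition nlft_factor (F : seqZ) (z : C) (k : Z) : mat2 :=
  let s := RtoC (/ sqrt (1 + Cmod (F k) ^ 2)) in
  Mat2 s (Cmult s (Cmult (F k) (zpow z k)))
       (Cmult s (Copp (Cmult (Cconj (F k)) (zpow z (- k)%Z)))) s.

Fixpoint nlft_prod (F : seqZ) (z : C) (m : Z) (len : nat) : mat2 :=
  match len with
  | O => mid
  | S l => mmul (nlft_factor F z m) (nlft_prod F z (m + 1)%Z l)
  end.

(** The SU(2) nonlinear Fourier series of F supported in [-N,N], evaluated at z: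
    first row (a(z), b(z)) of the ordered product over k = -N..N
    (factors with F_k = 0 are the identity, so this is the full product). *)
Definition nlfs_fin (F : seqZ) (N : nat) (z : C) : C * C :=
  let P := nlft_prod F z (- Z.of_nat N)%Z (2 * N + 1) in (m11 P, m12 P).

(** Real multilinear bounded maps (ℓ^1)^n -> A(T,C^2), represented by functions of
    an infinite family of vectors depending only on the first n. *)
Definition upd (v : nat -> seqZ) (i : nat) (x : seqZ) : nat -> seqZ :=
  fun j => if Nat.eqb j i then x else v j.

Fixpoint prod_norms (n : nat) (v : nat -> seqZ) : R :=
  match n with
  | O => 1
  | S m => prod_norms m v * l1_norm (v m)
  end.

Definition bounded_multilinear (n : nat) (A : (nat -> seqZ) -> pseq) (Cn : R) : Prop :=
  (forall v w : nat -> seqZ, (forall i, (i < n)%nat -> v i = w i) -> A v = A w) /\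
  (forall (v : nat -> seqZ) (i : nat) (x y : seqZ) (a b : R),
      (i < n)%nat -> (forall j, l1 (v j)) -> l1 x -> l1 y ->
      A (upd v i (sadd (sscal a x) (sscal b y))) =
      padd (pscal a (A (upd v i x))) (pscal b (A (upd v i y)))) /\
  (forall v : nat -> seqZ, (forall j, l1 (v j)) ->
      pl1 (A v) /\ pnorm (A v) <= Cn * prod_norms n v).

Fixpoint psum (N : nat) (f : nat -> pseq) : pseq :=
  match N with
  | O => pzero
  | S M => padd (psum M f) (f M)
  end.

Definition real_analytic_l1 (G : seqZ -> pseq) : Prop :=
  forall x0 : seqZ, l1 x0 ->
  exists (r : R) (A : nat -> (nat -> seqZ) -> pseq) (Cn : nat -> R),
    0 < r /\
    (forall n, bounded_multilinear n (A n) (Cn n)) /\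
    ex_series (fun n => Cn n * r ^ n) /\
    (forall h : seqZ, l1 h -> l1_norm h < r ->
       is_lim_seq (fun N => pnorm (psub (G (sadd x0 h)) (psum N (fun n => A n (fun _ => h))))) 0).

(* Main.v *)
(** The product over a growing window of integers is built one factor at a time; each factor changes
    the first row [(a, b)] by a real bilinear term of norm at most [|F k|] times that of the row, and
    the term exchanges the roles of [a] and [b]. Hence the unnormalised product converges for every
    summable [F], and inserting [x + h] and sorting by degree in [h] gives multilinear terms of norm
    at most [exp |x|]. The normalisation is [q ^ (- 1/2)] with [q = prod (1 + |F k|^2)], which by
    determinants is [|a|^2 + |b|^2] at [z = 1], a polynomial in bounded linear functionals of the
    unnormalised product; the binomial series then makes it analytic.

    For the estimates, subdividing the segment from [F] to [F'] reduces to nearby points. Let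
    [y k >= max |F k| |F' k|] have sum at most [S] and let [d = |F - F'|]. The even and odd parts
    [E], [O] of [prod (1 + y k)] satisfy [E + O <= exp S]; the unnormalised [b] has norm at most [O]
    and variation at most [E d], or [(E - 1) d] after removing the linear term; the normalisation is
    at least [1 - S^2 / 2] and varies by at most [d]. So [b] varies by at most [exp S * d], and
    [b - F] by at most [(exp S - 1 + S^2 / 2) d], which is below [d / 2] for [S = 0.36]. *)

Require Import Defs.
From Stdlib Require Import Reals ZArith Lra Lia List FinFun FunctionalExtensionality.
From Coquelicot Require Import Coquelicot.
Open Scope R_scope.

(** * Finite sums and summable sequences *)

(** A factor of the product only scales, shifts and possibly reflects and conjugates Fourier
    coefficients, so everything is done with coefficient sequences and no convolution appears. The
    conjugates make the map real but not complex analytic, hence real multilinear terms and real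
    coordinates.

    The factors [(1 + |F k|^2)^(-1/2)] would require an expansion of their own; reading their
    product off the unnormalised series reduces this to products of expansions and one composition.
    Each expansion carries a bound on its remainder after [N] terms, so that products and the
    composition are treated by finite sums, without rearranging infinite series.

    A common majorant of two sequences in the ball of radius [R] may have sum close to [2 R], which
    would give [e^(2 R)]; along a fine subdivision the excess over [R] is only the mesh. The second
    estimate then asks that [exp t - 1 + t^2 / 2] be at most [1 / 2], and equality holds just above
    [t = 0.36]. *)

Fixpoint rsum (N : nat) (f : nat -> R) : R :=
  match N with
  | O => 0
  | S M => rsum M f + f M
  end.

Lemma rsum_ext (N : nat) (f g : nat -> R) :
  (forall n, (n < N)%nat -> f n = g n) -> rsum N f = rsum N g.
Proof.
  induction N as [|N IH]; intros H; simpl; auto.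
  rewrite IH, H; auto.
Qed.

Lemma rsum_le (N : nat) (f g : nat -> R) :
  (forall n, (n < N)%nat -> f n <= g n) -> rsum N f <= rsum N g.
Proof.
  induction N as [|N IH]; intros H; simpl; [lra|].
  apply Rplus_le_compat; auto.
Qed.

Lemma rsum_ge0 (N : nat) (f : nat -> R) :
  (forall n, (n < N)%nat -> 0 <= f n) -> 0 <= rsum N f.
Proof.
  induction N as [|N IH]; intros H; simpl; [lra|].
  apply Rplus_le_le_0_compat; auto.
Qed.

Lemma rsum_plus (N : nat) (f g : nat -> R) :
  rsum N (fun n => f n + g n) = rsum N f + rsum N g.
Proof. induction N as [|N IH]; simpl; [ring | rewrite IH; ring]. Qed.

Lemma rsum_scal (N : nat) (c : R) (f : nat -> R) :
  rsum N (fun n => c * f n) = c * rsum N f.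
Proof. induction N as [|N IH]; simpl; [ring | rewrite IH; ring]. Qed.

Lemma rsum_const (N : nat) (c : R) : rsum N (fun _ => c) = INR N * c.
Proof.
  induction N as [|N IH]; [simpl; ring|].
  rewrite S_INR; simpl rsum; rewrite IH; ring.
Qed.

Lemma Rabs_rsum_le (N : nat) (f : nat -> R) :
  Rabs (rsum N f) <= rsum N (fun n => Rabs (f n)).
Proof.
  induction N as [|N IH]; simpl; [rewrite Rabs_R0; lra|].
  eapply Rle_trans; [apply Rabs_triang | lra].
Qed.

Lemma sum_n_rsum (a : nat -> R) (N : nat) : sum_n a N = rsum (S N) a.
Proof.
  induction N as [|N IH]; [rewrite sum_O; simpl; ring|].
  rewrite sum_Sn, IH; reflexivity.
Qed.

Lemma is_lim_seq_rsum (a : nat -> R) :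
  ex_series a -> is_lim_seq (fun N => rsum N a) (Series a).
Proof.
  intros H; apply is_lim_seq_incr_1.
  apply is_lim_seq_ext with (sum_n a); [apply sum_n_rsum|].
  apply Series_correct in H; exact H.
Qed.

Lemma rsum_le_Series (a : nat -> R) (N : nat) :
  (forall n, 0 <= a n) -> ex_series a -> rsum N a <= Series a.
Proof.
  intros Ha He.
  apply (is_lim_seq_incr_compare (fun N => rsum N a)); [now apply is_lim_seq_rsum|].
  intros n; simpl; specialize (Ha n); lra.
Qed.

Lemma series_of_rsum_le (a : nat -> R) (K : R) :
  (forall n, 0 <= a n) -> (forall N, rsum N a <= K) -> ex_series a /\ Series a <= K.
Proof.
  intros Ha HK.
  assert (He : ex_series a).
  { destruct (ex_finite_lim_seq_incr (sum_n a) K) as [l Hl].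
    - intros n; rewrite sum_Sn; change plus with Rplus; specialize (Ha (S n)); lra.
    - intros n; rewrite sum_n_rsum; apply HK.
    - exists l; exact Hl. }
  split; auto.
  apply (is_lim_seq_le (fun N => rsum N a) (fun _ => K) (Series a) K);
    [apply HK | now apply is_lim_seq_rsum | apply is_lim_seq_const].
Qed.

Lemma prod_norms_ge0 (n : nat) (v : nat -> seqZ) :
  (forall j, 0 <= l1_norm (v j)) -> 0 <= prod_norms n v.
Proof. intros H; induction n as [|n IH]; simpl; [lra | apply Rmult_le_pos; auto]. Qed.

(** [Series] takes a default value on a divergent series, so a bound on [l1_norm] means something
    only together with summability. *)
Definition l1le (F : seqZ) (K : R) : Prop := l1 F /\ l1_norm F <= K.

(** * Norms through sums over finite lists of integers *)

Fixpoint lsum (F : seqZ) (L : list Z) : R :=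
  match L with
  | nil => 0
  | k :: L' => Cmod (F k) + lsum F L'
  end.

Lemma lsum_app (F : seqZ) (L L' : list Z) : lsum F (L ++ L') = lsum F L + lsum F L'.
Proof. induction L as [|k L IH]; simpl; [ring | rewrite IH; ring]. Qed.

Lemma lsum_ge0 (F : seqZ) (L : list Z) : 0 <= lsum F L.
Proof. induction L as [|k L IH]; simpl; [lra | pose proof (Cmod_ge_0 (F k)); lra]. Qed.

Lemma lsum_incl (F : seqZ) (L L' : list Z) : NoDup L -> incl L L' -> lsum F L <= lsum F L'.
Proof.
  intros HL; revert L'; induction HL as [|k L Hk HL IH]; intros L' Hi; simpl.
  - apply lsum_ge0.
  - destruct (in_split k L') as (l & r & ->); [apply Hi; now left|].
    rewrite lsum_app; simpl.
    assert (lsum F L <= lsum F (l ++ r)) by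
      (apply IH; intros x Hx;
       assert (Hx' : In x (l ++ k :: r)) by (apply Hi; now right);
       apply in_app_iff in Hx'; apply in_app_iff; simpl in Hx';
       destruct Hx' as [|[->|]]; tauto).
    rewrite lsum_app in H; lra.
Qed.

Fixpoint window (N : nat) : list Z :=
  match N with
  | O => nil
  | S n => Z.of_nat n :: (- Z.of_nat n - 1)%Z :: window n
  end.

Lemma in_window (N : nat) (k : Z) : In k (window N) <-> (- Z.of_nat N <= k < Z.of_nat N)%Z.
Proof. induction N as [|N IH]; [simpl; lia | cbn [window In]; rewrite IH; lia]. Qed.

Lemma NoDup_window (N : nat) : NoDup (window N).
Proof.
  induction N as [|N IH]; simpl; [constructor|].
  constructor; [simpl; rewrite in_window; lia|].
  constructor; [rewrite in_window; lia | exact IH].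
Qed.

Lemma lsum_window (F : seqZ) (N : nat) :
  lsum F (window N) = rsum N (fun n => Cmod (F (Z.of_nat n)) + Cmod (F (- Z.of_nat n - 1)%Z)).
Proof. induction N as [|N IH]; simpl; [ring | rewrite IH; ring]. Qed.

Lemma list_in_window (L : list Z) : exists N, incl L (window N).
Proof.
  induction L as [|k L [N HN]]; [exists O; intros x []|].
  exists (N + Z.to_nat (Z.abs k) + 1)%nat; intros x [<-|Hx]; rewrite in_window; [lia|].
  apply HN in Hx; rewrite in_window in Hx; lia.
Qed.

Lemma l1_term_ge0 (F : seqZ) (n : nat) :
  0 <= Cmod (F (Z.of_nat n)) + Cmod (F (- Z.of_nat n - 1)%Z).
Proof. apply Rplus_le_le_0_compat; apply Cmod_ge_0. Qed.

Lemma lsum_le_l1_norm (F : seqZ) (L : list Z) : l1 F -> NoDup L -> lsum F L <= l1_norm F.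
Proof.
  intros HF HL; destruct (list_in_window L) as [N HN].
  eapply Rle_trans; [apply (lsum_incl F L (window N)); auto|].
  rewrite lsum_window; apply rsum_le_Series; auto; apply l1_term_ge0.
Qed.

(** Sums over duplicate-free lists do not depend on the enumeration of the integers; changes of
    index then act by mapping lists. *)
Lemma l1le_of_lsum (F : seqZ) (K : R) : (forall L, NoDup L -> lsum F L <= K) -> l1le F K.
Proof.
  intros H; apply series_of_rsum_le; [apply l1_term_ge0|].
  intros N; rewrite <- lsum_window; apply H, NoDup_window.
Qed.

Lemma l1le_lsum (F : seqZ) (K : R) (L : list Z) : l1le F K -> NoDup L -> lsum F L <= K.
Proof. intros [H1 H2] HL; eapply Rle_trans; [apply lsum_le_l1_norm|]; eauto. Qed.

Lemma l1le_norm (F : seqZ) : l1 F -> l1le F (l1_norm F).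
Proof. intros H; split; auto; apply Rle_refl. Qed.

Lemma l1le_mono (F : seqZ) (K K' : R) : l1le F K -> K <= K' -> l1le F K'.
Proof. intros [H1 H2] H; split; auto; lra. Qed.

Lemma l1le_ge0 (F : seqZ) (K : R) : l1le F K -> 0 <= K.
Proof. intros H; apply (l1le_lsum F K nil H); constructor. Qed.

Lemma l1_norm_ge0 (F : seqZ) : l1 F -> 0 <= l1_norm F.
Proof. intros H; now apply l1le_ge0 with F, l1le_norm. Qed.

Lemma l1le_Cmod (F : seqZ) (K : R) (k : Z) : l1le F K -> Cmod (F k) <= K.
Proof.
  intros H; replace (Cmod (F k)) with (lsum F (k :: nil)) by (simpl; ring).
  apply (l1le_lsum F K _ H); constructor; [easy | constructor].
Qed.

Lemma l1le_add (F G H : seqZ) (K K' : R) :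
  l1le F K -> l1le G K' -> (forall k, Cmod (H k) <= Cmod (F k) + Cmod (G k)) ->
  l1le H (K + K').
Proof.
  intros HF HG Hb; apply l1le_of_lsum; intros L HL.
  apply Rle_trans with (lsum F L + lsum G L).
  - clear HL; induction L as [|k L IH]; simpl; [lra | specialize (Hb k); lra].
  - apply Rplus_le_compat; apply l1le_lsum; auto.
Qed.

(** Injectivity of [phi] keeps lists free of duplicates. With a translation or a reflection for
    [phi], this bounds multiplication by a monomial and conjugation on the circle. *)
Lemma l1le_comp (phi : Z -> Z) (c : R) (F G : seqZ) (K : R) :
  (forall i j, phi i = phi j -> i = j) -> 0 <= c -> l1le F K ->
  (forall k, Cmod (G k) <= c * Cmod (F (phi k))) -> l1le G (c * K).
Proof.
  intros Hphi Hc HF Hb; apply l1le_of_lsum; intros L HL.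
  apply Rle_trans with (c * lsum F (map phi L)).
  - clear HL; induction L as [|k L IH]; simpl; [lra | specialize (Hb k); lra].
  - apply Rmult_le_compat_l; auto; apply l1le_lsum; auto.
    apply Injective_map_NoDup; auto; exact Hphi.
Qed.

Lemma l1le_sadd (F G : seqZ) (K K' : R) : l1le F K -> l1le G K' -> l1le (sadd F G) (K + K').
Proof. intros HF HG; apply (l1le_add F G); auto; intros k; apply Cmod_triangle. Qed.

Lemma l1le_ssub (F G : seqZ) (K K' : R) : l1le F K -> l1le G K' -> l1le (ssub F G) (K + K').
Proof.
  intros HF HG; apply (l1le_add F G); auto; intros k; unfold ssub, Cminus.
  rewrite <- (Cmod_opp (G k)); apply Cmod_triangle.
Qed.

Lemma l1le_sscal (c : R) (F : seqZ) (K : R) : l1le F K -> l1le (sscal c F) (Rabs c * K).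
Proof.
  intros HF; apply (l1le_comp (fun k => k) (Rabs c) F); auto using Rabs_pos.
  intros k; unfold sscal; rewrite Cmod_mult, Cmod_R; lra.
Qed.

Lemma l1le_zero : l1le (fun _ => RtoC 0) 0.
Proof.
  apply l1le_of_lsum; intros L _; induction L; simpl; [lra | rewrite Cmod_0; lra].
Qed.

Lemma l1_sadd (F G : seqZ) : l1 F -> l1 G -> l1 (sadd F G).
Proof. intros HF HG; exact (proj1 (l1le_sadd F G _ _ (l1le_norm F HF) (l1le_norm G HG))). Qed.

Lemma l1_ssub (F G : seqZ) : l1 F -> l1 G -> l1 (ssub F G).
Proof. intros HF HG; exact (proj1 (l1le_ssub F G _ _ (l1le_norm F HF) (l1le_norm G HG))). Qed.

Lemma l1_sscal (c : R) (F : seqZ) : l1 F -> l1 (sscal c F).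
Proof. intros HF; exact (proj1 (l1le_sscal c F _ (l1le_norm F HF))). Qed.

(** Balls are closed: every finite sum of [l] is at most [tau m + (K + tau m)], and [m] tends to
    infinity. *)
Lemma l1le_limit (u : nat -> seqZ) (l : seqZ) (tau : nat -> R) (K : R) :
  is_lim_seq tau 0 -> (forall m, l1le (u m) (K + tau m)) ->
  (forall m, l1le (ssub l (u m)) (tau m)) -> l1le l K.
Proof.
  intros Ht Hu Hl; apply l1le_of_lsum; intros L HL.
  apply (is_lim_seq_le (fun _ => lsum l L) (fun m => tau m + (K + tau m)) (lsum l L) K).
  - intros m; apply (l1le_lsum l); auto.
    apply (l1le_add _ _ _ _ _ (Hl m) (Hu m)); intros k; unfold ssub.
    replace (l k) with (l k - u m k + u m k)%C at 1 by ring; apply Cmod_triangle.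
  - apply is_lim_seq_const.
  - replace (Finite K) with (Finite (0 + (K + 0))) by (f_equal; ring).
    apply is_lim_seq_plus'; auto; apply is_lim_seq_plus'; auto; apply is_lim_seq_const.
Qed.

(** * Convergence in the Wiener algebra *)

Lemma pseq_ext (p q : pseq) :
  (forall k, fst p k = fst q k) -> (forall k, snd p k = snd q k) -> p = q.
Proof.
  destruct p as [a b], q as [a' b']; cbn; intros H1 H2.
  f_equal; apply functional_extensionality; assumption.
Qed.

Ltac pseq_ring :=
  apply pseq_ext; intros ?; unfold padd, psub, pscal, pzero, sadd, ssub, sscal; cbn [fst snd]; ring.

Definition ple (p : pseq) (K : R) : Prop := pl1 p /\ pnorm p <= K.

Lemma ple_pair (p : pseq) (K1 K2 : R) :
  l1le (fst p) K1 -> l1le (snd p) K2 -> ple p (K1 + K2).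
Proof. intros [H1 H2] [H3 H4]; split; [split; auto | unfold pnorm; lra]. Qed.

Lemma ple_fst (p : pseq) (K : R) : ple p K -> l1le (fst p) K.
Proof.
  intros [[H1 H2] H3]; split; auto; pose proof (l1_norm_ge0 _ H2); unfold pnorm in H3; lra.
Qed.

Lemma ple_snd (p : pseq) (K : R) : ple p K -> l1le (snd p) K.
Proof.
  intros [[H1 H2] H3]; split; auto; pose proof (l1_norm_ge0 _ H1); unfold pnorm in H3; lra.
Qed.

Lemma ple_norm (p : pseq) : pl1 p -> ple p (pnorm p).
Proof. intros H; split; auto; lra. Qed.

Lemma ple_mono (p : pseq) (K K' : R) : ple p K -> K <= K' -> ple p K'.
Proof. intros [H1 H2] H; split; auto; lra. Qed.

Lemma ple_ge0 (p : pseq) (K : R) : ple p K -> 0 <= K.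
Proof. intros H; apply l1le_ge0 with (fst p); now apply ple_fst. Qed.

Lemma ple_padd (p q : pseq) (K K' : R) : ple p K -> ple q K' -> ple (padd p q) (K + K').
Proof.
  intros [[H1 H2] H3] [[H4 H5] H6]; unfold pnorm in *.
  apply ple_mono with ((l1_norm (fst p) + l1_norm (fst q)) + (l1_norm (snd p) + l1_norm (snd q)));
    [|lra].
  apply ple_pair; apply l1le_sadd; now apply l1le_norm.
Qed.

Lemma ple_pscal (c : R) (p : pseq) (K : R) : ple p K -> ple (pscal c p) (Rabs c * K).
Proof.
  intros [[H1 H2] H3]; unfold pnorm in *.
  apply ple_mono with (Rabs c * l1_norm (fst p) + Rabs c * l1_norm (snd p)).
  - apply ple_pair; apply l1le_sscal; now apply l1le_norm.
  - pose proof (Rabs_pos c); nra.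
Qed.

Lemma ple_psub (p q : pseq) (K K' : R) : ple p K -> ple q K' -> ple (psub p q) (K + K').
Proof.
  intros Hp Hq; replace (psub p q) with (padd p (pscal (-1) q)) by pseq_ring.
  apply ple_padd; auto; replace K' with (Rabs (-1) * K'); [now apply ple_pscal|].
  rewrite Rabs_left; lra.
Qed.

Lemma ple_zero : ple pzero 0.
Proof. replace 0 with (0 + 0) by ring; apply ple_pair; apply l1le_zero. Qed.

Lemma ple_0_eq (p q : pseq) : ple (psub p q) 0 -> p = q.
Proof.
  intros H; apply pseq_ext; intros k.
  - pose proof (l1le_Cmod _ _ k (ple_fst _ _ H)) as Hk; cbn in Hk; unfold ssub in Hk.
    assert (E : (fst p k - fst q k)%C = 0) by (apply Cmod_eq_0; pose proof (Cmod_ge_0 (fst p k - fst q k)); lra).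
    replace (fst p k) with (fst p k - fst q k + fst q k)%C by ring; rewrite E; ring.
  - pose proof (l1le_Cmod _ _ k (ple_snd _ _ H)) as Hk; cbn in Hk; unfold ssub in Hk.
    assert (E : (snd p k - snd q k)%C = 0) by (apply Cmod_eq_0; pose proof (Cmod_ge_0 (snd p k - snd q k)); lra).
    replace (snd p k) with (snd p k - snd q k + snd q k)%C by ring; rewrite E; ring.
Qed.

(** Convergence is stated with an explicit null majorant, so that summability of the differences is
    part of it and errors can be added. *)
Definition pconv (u : nat -> pseq) (l : pseq) : Prop :=
  exists tau : nat -> R, is_lim_seq tau 0 /\ forall m, ple (psub l (u m)) (tau m).

Lemma is_lim_seq_plus0 (u v : nat -> R) :
  is_lim_seq u 0 -> is_lim_seq v 0 -> is_lim_seq (fun n => u n + v n) 0.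
Proof.
  intros Hu Hv; replace (Finite 0) with (Finite (0 + 0)) by (f_equal; ring).
  now apply is_lim_seq_plus'.
Qed.

Lemma is_lim_seq_scal0 (c : R) (u : nat -> R) :
  is_lim_seq u 0 -> is_lim_seq (fun n => c * u n) 0.
Proof.
  intros Hu; replace (Finite 0) with (Rbar_mult c 0) by (simpl; f_equal; ring).
  now apply is_lim_seq_scal_l.
Qed.

Lemma le_of_is_lim_seq0 (x y : R) (tau : nat -> R) :
  is_lim_seq tau 0 -> (forall m, x <= y + tau m) -> x <= y.
Proof.
  intros Ht H; apply (is_lim_seq_le (fun _ => x) (fun m => y + tau m) x y); auto.
  - apply is_lim_seq_const.
  - replace (Finite y) with (Finite (y + 0)) by (f_equal; ring).
    apply is_lim_seq_plus'; auto; apply is_lim_seq_const.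
Qed.

Lemma ple_limit (p : pseq) (K : R) (tau : nat -> R) :
  is_lim_seq tau 0 -> (forall m, ple p (K + tau m)) -> ple p K.
Proof.
  intros Ht H; split; [exact (proj1 (H O))|].
  apply (le_of_is_lim_seq0 _ _ tau); auto; intros m; exact (proj2 (H m)).
Qed.

Lemma pconv_ple (u : nat -> pseq) (l : pseq) (K : R) :
  pconv u l -> (forall m, ple (u m) K) -> ple l K.
Proof.
  intros (tau & Ht & H) Hu; apply (ple_limit l K tau Ht); intros m.
  replace l with (padd (u m) (psub l (u m))) by pseq_ring.
  now apply ple_padd.
Qed.

Lemma pconv_unique (u : nat -> pseq) (l l' : pseq) : pconv u l -> pconv u l' -> l = l'.
Proof.
  intros (tau & Ht & H) (tau' & Ht' & H'); apply ple_0_eq.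
  apply (ple_limit _ 0 (fun m => tau m + tau' m)); [now apply is_lim_seq_plus0|].
  intros m; rewrite Rplus_0_l.
  replace (psub l l') with (psub (psub l (u m)) (psub l' (u m))) by pseq_ring.
  now apply ple_psub.
Qed.

Lemma pconv_padd (u u' : nat -> pseq) (l l' : pseq) :
  pconv u l -> pconv u' l' -> pconv (fun m => padd (u m) (u' m)) (padd l l').
Proof.
  intros (tau & Ht & H) (tau' & Ht' & H').
  exists (fun m => tau m + tau' m); split; [now apply is_lim_seq_plus0|].
  intros m; replace (psub (padd l l') (padd (u m) (u' m)))
    with (padd (psub l (u m)) (psub l' (u' m))) by pseq_ring.
  now apply ple_padd.
Qed.

Lemma pconv_pscal (c : R) (u : nat -> pseq) (l : pseq) :
  pconv u l -> pconv (fun m => pscal c (u m)) (pscal c l).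
Proof.
  intros (tau & Ht & H); exists (fun m => Rabs c * tau m); split.
  - now apply is_lim_seq_scal0.
  - intros m; replace (psub (pscal c l) (pscal c (u m))) with (pscal c (psub l (u m))) by pseq_ring.
    now apply ple_pscal.
Qed.

Lemma pconv_const (p : pseq) : pconv (fun _ => p) p.
Proof.
  exists (fun _ => 0); split; [apply is_lim_seq_const|]; intros _.
  replace (psub p p) with pzero by pseq_ring; apply ple_zero.
Qed.

Lemma pconv_psub (u u' : nat -> pseq) (l l' : pseq) :
  pconv u l -> pconv u' l' -> pconv (fun m => psub (u m) (u' m)) (psub l l').
Proof.
  intros (tau & Ht & H) (tau' & Ht' & H').
  exists (fun m => tau m + tau' m); split; [now apply is_lim_seq_plus0|].
  intros m; replace (psub (psub l l') (psub (u m) (u' m)))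
    with (psub (psub l (u m)) (psub l' (u' m))) by pseq_ring.
  now apply ple_psub.
Qed.

Lemma pconv_psum (N : nat) (u : nat -> nat -> pseq) (l : nat -> pseq) :
  (forall n, pconv (u n) (l n)) -> pconv (fun m => psum N (fun n => u n m)) (psum N l).
Proof.
  intros H; induction N as [|N IH]; simpl; [apply pconv_const | now apply pconv_padd].
Qed.

Lemma pconv_eventually (u : nat -> pseq) (l : pseq) (M : nat) :
  pconv u l -> (forall m, (M <= m)%nat -> u m = u M) -> l = u M.
Proof.
  intros (tau & Ht & H) HM; apply ple_0_eq.
  apply (ple_limit _ 0 (fun m => tau (m + M)%nat)); [now apply is_lim_seq_incr_n|].
  intros m; rewrite Rplus_0_l, <- (HM (m + M)%nat) by lia; apply H.
Qed.

(** * Completeness: limits of sequences with summable increments *)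

Definition slim (u : nat -> seqZ) : seqZ :=
  fun k => (real (Lim_seq (fun m => Re (u m k))), real (Lim_seq (fun m => Im (u m k)))).

Lemma Rabs_Im_le_Cmod (c : C) : Rabs (Im c) <= Cmod c.
Proof. eapply Rle_trans; [apply Rmax_r | apply Rmax_Cmod]. Qed.

Lemma Cmod_le_Re_Im (c : C) : Cmod c <= Rabs (Re c) + Rabs (Im c).
Proof.
  unfold Cmod; pose proof (Rabs_pos (fst c)); pose proof (Rabs_pos (snd c)).
  rewrite <- (sqrt_pow2 (Rabs (Re c) + Rabs (Im c))) by (unfold Re, Im; lra).
  apply sqrt_le_1_alt; rewrite <- (pow2_abs (fst c)), <- (pow2_abs (snd c)); unfold Re, Im; nra.
Qed.

Lemma is_lim_seq_increments (x eps : nat -> R) :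
  (forall m, Rabs (x (S m) - x m) <= eps m) -> ex_series eps -> is_lim_seq x (Lim_seq x) /\ is_finite (Lim_seq x).
Proof.
  intros H He; assert (Hs : ex_series (fun m => x (S m) - x m)).
  { apply (ex_series_le (K := R_AbsRing) (V := R_CompleteNormedModule)) with eps; auto. }
  assert (Hl : is_lim_seq x (x O + Series (fun m => x (S m) - x m))).
  { apply is_lim_seq_ext with (fun m => x O + rsum m (fun m => x (S m) - x m)).
    - intros m; induction m as [|m IH]; simpl; [ring | lra].
    - apply is_lim_seq_plus'; [apply is_lim_seq_const | now apply is_lim_seq_rsum]. }
  rewrite (is_lim_seq_unique _ _ Hl); split; auto; reflexivity.
Qed.

Lemma l1le_increments (u : nat -> seqZ) (eps : nat -> R) (m n : nat) :
  (forall m, l1le (ssub (u (S m)) (u m)) (eps m)) -> (m <= n)%nat ->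
  l1le (ssub (u n) (u m)) (rsum n eps - rsum m eps).
Proof.
  intros H Hmn; induction Hmn as [|n Hmn IH].
  - replace (rsum m eps - rsum m eps) with 0 by ring.
    replace (ssub (u m) (u m)) with (fun _ : Z => RtoC 0); [apply l1le_zero|].
    apply functional_extensionality; intros k; unfold ssub; ring.
  - simpl; replace (rsum n eps + eps n - rsum m eps) with (eps n + (rsum n eps - rsum m eps)) by ring.
    apply (l1le_add _ _ _ _ _ (H n) IH); intros k; unfold ssub.
    replace (u (S n) k - u m k)%C with (u (S n) k - u n k + (u n k - u m k))%C by ring.
    apply Cmod_triangle.
Qed.

(** Summable increments give a limit in each coordinate. On a fixed finite list the distance from
    [u (n + m)] to this limit vanishes as [n] grows, while the distance from [u m] to [u (n + m)] is
    bounded by the tail of [eps] for every [n]. *)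
Lemma l1le_slim (u : nat -> seqZ) (eps : nat -> R) (m : nat) :
  (forall m, l1le (ssub (u (S m)) (u m)) (eps m)) -> ex_series eps ->
  l1le (ssub (slim u) (u m)) (Series eps - rsum m eps).
Proof.
  intros H He.
  assert (Heps : forall n, 0 <= eps n) by (intros n; apply (l1le_ge0 _ _ (H n))).
  assert (Hk : forall k, is_lim_seq (fun n => Cmod (slim u k - u n k)) 0).
  { intros k.
    destruct (is_lim_seq_increments (fun n => Re (u n k)) eps) as [Hr Hr']; auto.
    { intros n; eapply Rle_trans; [|apply (l1le_Cmod _ _ k (H n))]; unfold ssub.
      eapply Rle_trans; [|apply re_le_Cmod]; right; reflexivity. }
    destruct (is_lim_seq_increments (fun n => Im (u n k)) eps) as [Hi Hi']; auto.
    { intros n; eapply Rle_trans; [|apply (l1le_Cmod _ _ k (H n))]; unfold ssub.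
      eapply Rle_trans; [|apply Rabs_Im_le_Cmod]; right; reflexivity. }
    assert (Hd : forall x, is_lim_seq x (Lim_seq x) -> is_finite (Lim_seq x) ->
                   is_lim_seq (fun n => Rabs (real (Lim_seq x) - x n)) 0).
    { intros x Hx Hf; rewrite <- Hf in Hx.
      replace (Finite 0) with (Rbar_abs (Finite (real (Lim_seq x) - real (Lim_seq x))))
        by (simpl; rewrite Rminus_diag, Rabs_R0; reflexivity).
      apply is_lim_seq_abs, is_lim_seq_minus'; auto; apply is_lim_seq_const. }
    apply is_lim_seq_le_le with (fun _ => 0)
      (fun n => Rabs (Re (slim u k) - Re (u n k)) + Rabs (Im (slim u k) - Im (u n k))).
    - intros n; split; [apply Cmod_ge_0|]; eapply Rle_trans; [apply Cmod_le_Re_Im|].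
      right; reflexivity.
    - apply is_lim_seq_const.
    - apply is_lim_seq_plus0; [now apply (Hd (fun n => Re (u n k))) | now apply (Hd (fun n => Im (u n k)))]. }
  apply l1le_of_lsum; intros L HL.
  assert (Hl : is_lim_seq (fun n => lsum (ssub (slim u) (u (n + m)%nat)) L) 0).
  { apply (is_lim_seq_incr_n (fun n => lsum (ssub (slim u) (u n)) L)).
    clear HL; induction L as [|k L IH]; simpl; [apply is_lim_seq_const|].
    apply is_lim_seq_plus0; auto; apply Hk. }
  apply (le_of_is_lim_seq0 _ _ _ Hl); intros n.
  apply Rle_trans with (lsum (ssub (u (n + m)%nat) (u m)) L + lsum (ssub (slim u) (u (n + m)%nat)) L).
  - clear; induction L as [|k L IH]; simpl; [lra|]; unfold ssub at 1 3 5.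
    pose proof (Cmod_triangle (u (n + m)%nat k - u m k) (slim u k - u (n + m)%nat k)) as Ht.
    replace (u (n + m)%nat k - u m k + (slim u k - u (n + m)%nat k))%C
      with (slim u k - u m k)%C in Ht by ring; lra.
  - apply Rplus_le_compat_r; eapply Rle_trans.
    + apply l1le_lsum; [apply (l1le_increments u eps m (n + m)) | exact HL]; auto; lia.
    + pose proof (rsum_le_Series eps (n + m) Heps He); lra.
Qed.

Definition plim (u : nat -> pseq) : pseq := (slim (fun m => fst (u m)), slim (fun m => snd (u m))).

Lemma pconv_plim (u : nat -> pseq) (eps : nat -> R) :
  (forall m, ple (psub (u (S m)) (u m)) (eps m)) -> ex_series eps -> pconv u (plim u).
Proof.
  intros H He; exists (fun m => (Series eps - rsum m eps) + (Series eps - rsum m eps)); split.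
  - assert (H0 : is_lim_seq (fun m => Series eps - rsum m eps) 0).
    { replace (Finite 0) with (Finite (Series eps - Series eps)) by (f_equal; ring).
      apply is_lim_seq_minus'; [apply is_lim_seq_const | now apply is_lim_seq_rsum]. }
    now apply is_lim_seq_plus0.
  - intros m; apply ple_pair.
    + apply (l1le_slim (fun m => fst (u m))); auto; intros j; apply (ple_fst _ _ (H j)).
    + apply (l1le_slim (fun m => snd (u m))); auto; intros j; apply (ple_snd _ _ (H j)).
Qed.

(** * Unnormalised products and their multilinear expansions *)

(* Enumerates the integers as 0, -1, 1, -2, 2, ...: the ordered product over a window grows
   alternately by a factor on the right and a factor on the left. *)
Definition site (m : nat) : Z :=
  if Nat.even m then Z.of_nat (Nat.div2 m) else (- Z.of_nat (Nat.div2 m) - 1)%Z.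

Lemma site_double (n : nat) : site (2 * n) = Z.of_nat n.
Proof. unfold site; rewrite Nat.even_even, Nat.div2_double; reflexivity. Qed.

Lemma site_double_S (n : nat) : site (S (2 * n)) = (- Z.of_nat n - 1)%Z.
Proof.
  unfold site; rewrite Nat.even_succ, <- Nat.negb_even, Nat.even_even, Nat.div2_succ_double.
  reflexivity.
Qed.

Lemma nat_parity (m : nat) : exists n, m = (2 * n)%nat \/ m = S (2 * n).
Proof.
  destruct (Nat.Even_or_Odd m) as [[n ->]|[n ->]]; exists n; [left | right]; lia.
Qed.

Lemma site_inj (m n : nat) : site m = site n -> m = n.
Proof.
  destruct (nat_parity m) as [i [-> | ->]], (nat_parity n) as [j [-> | ->]];
    rewrite ?site_double, ?site_double_S; lia.
Qed.

Definition mass (F : seqZ) (m : nat) : R := rsum m (fun j => Cmod (F (site j))).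

Lemma mass_ge0 (F : seqZ) (m : nat) : 0 <= mass F m.
Proof. apply rsum_ge0; intros; apply Cmod_ge_0. Qed.

Lemma mass_le_l1_norm (F : seqZ) (m : nat) : l1 F -> mass F m <= l1_norm F.
Proof.
  intros HF; replace (mass F m) with (lsum F (map site (rev (seq 0 m)))).
  - apply lsum_le_l1_norm; auto.
    apply Injective_map_NoDup; [exact site_inj | apply NoDup_rev, seq_NoDup].
  - unfold mass; induction m as [|m IH]; [reflexivity|].
    rewrite seq_S, rev_app_distr; simpl; rewrite IH; ring.
Qed.

Lemma ex_series_site (F : seqZ) : l1 F -> ex_series (fun j => Cmod (F (site j))).
Proof.
  intros HF; apply (series_of_rsum_le _ (l1_norm F)); [intros; apply Cmod_ge_0|].
  intros N; now apply mass_le_l1_norm.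
Qed.

(* The increment of the first row [(a, b)] when the product is multiplied by the factor at
   [k = site m] with entry [u], on the right for [k >= 0], on the left for [k < 0]. The left
   multiplication acts on first rows because the second row consists of [- b^] and [a^], where
   [f^ (z) = conj (f (1 / conj z))]. *)
Definition step (m : nat) (u : C) (s : pseq) : pseq :=
  if Nat.even m
  then (fun n => (- Cconj u * snd s (n + site m)%Z)%C, fun n => (u * fst s (n - site m)%Z)%C)
  else (fun n => (- u * Cconj (snd s (site m - n)%Z))%C, fun n => (u * Cconj (fst s (site m - n)%Z))%C).

Lemma step_fst_l1le (m : nat) (u : C) (s : pseq) (K : R) :
  l1le (snd s) K -> l1le (fst (step m u s)) (Cmod u * K).
Proof.
  intros H; unfold step; destruct (Nat.even m); cbn.
  - apply (l1le_comp (fun n => n + site m)%Z _ (snd s)); auto using Cmod_ge_0; [lia|].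
    intros k; rewrite Cmod_mult, Cmod_opp, Cmod_conj; lra.
  - apply (l1le_comp (fun n => site m - n)%Z _ (snd s)); auto using Cmod_ge_0; [lia|].
    intros k; rewrite Cmod_mult, Cmod_opp, Cmod_conj; lra.
Qed.

Lemma step_snd_l1le (m : nat) (u : C) (s : pseq) (K : R) :
  l1le (fst s) K -> l1le (snd (step m u s)) (Cmod u * K).
Proof.
  intros H; unfold step; destruct (Nat.even m); cbn.
  - apply (l1le_comp (fun n => n - site m)%Z _ (fst s)); auto using Cmod_ge_0; [lia|].
    intros k; rewrite Cmod_mult; lra.
  - apply (l1le_comp (fun n => site m - n)%Z _ (fst s)); auto using Cmod_ge_0; [lia|].
    intros k; rewrite Cmod_mult, Cmod_conj; lra.
Qed.

Lemma ple_step (m : nat) (u : C) (s : pseq) (K : R) : ple s K -> ple (step m u s) (Cmod u * K).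
Proof.
  intros [[H1 H2] H3]; unfold pnorm in H3.
  apply ple_mono with (Cmod u * l1_norm (snd s) + Cmod u * l1_norm (fst s)).
  - apply ple_pair; [apply step_fst_l1le | apply step_snd_l1le]; now apply l1le_norm.
  - pose proof (Cmod_ge_0 u); nra.
Qed.

Lemma Cconj_RtoC (c : R) : Cconj (RtoC c) = RtoC c.
Proof. unfold Cconj, RtoC; cbn; f_equal; ring. Qed.

Ltac step_ring :=
  unfold step; destruct (Nat.even _); apply pseq_ext; intros ?;
  unfold padd, psub, pscal, pzero, sadd, ssub, sscal; cbn [fst snd];
  rewrite ?Cplus_conj, ?Cminus_conj, ?Cmult_conj, ?Cconj_RtoC; ring.

Lemma step_padd (m : nat) (u : C) (s t : pseq) :
  step m u (padd s t) = padd (step m u s) (step m u t).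
Proof. step_ring. Qed.

Lemma step_psub (m : nat) (u : C) (s t : pseq) :
  step m u (psub s t) = psub (step m u s) (step m u t).
Proof. step_ring. Qed.

Lemma step_pscal (m : nat) (u : C) (c : R) (s : pseq) :
  step m u (pscal c s) = pscal c (step m u s).
Proof. step_ring. Qed.

Lemma step_pzero (m : nat) (u : C) : step m u pzero = pzero.
Proof. step_ring. Qed.

Lemma step_plus_l (m : nat) (u w : C) (s : pseq) :
  step m (u + w) s = padd (step m u s) (step m w s).
Proof. step_ring. Qed.

Lemma step_minus_l (m : nat) (u w : C) (s : pseq) :
  step m (u - w) s = psub (step m u s) (step m w s).
Proof. step_ring. Qed.

Lemma step_scal_l (m : nat) (c : R) (u : C) (s : pseq) :
  step m (c * u) s = pscal c (step m u s).
Proof. step_ring. Qed.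

Lemma step_0_l (m : nat) (s : pseq) : step m 0 s = pzero.
Proof. step_ring. Qed.

(** * The multilinear terms of the unnormalised product *)

Definition pone : pseq := (fun k => if Z.eqb k 0 then RtoC 1 else RtoC 0, fun _ => RtoC 0).

Lemma l1le_delta (j : Z) (u : C) : l1le (fun k => if Z.eqb k j then u else RtoC 0) (Cmod u).
Proof.
  apply l1le_of_lsum; intros L HL; induction HL as [|k L Hk HL IH]; simpl; [apply Cmod_ge_0|].
  destruct (Z.eqb_spec k j) as [->|Hkj]; [|rewrite Cmod_0; lra].
  assert (E : lsum (fun k => if Z.eqb k j then u else RtoC 0) L = 0); [|lra].
  clear IH HL; induction L as [|i L IH]; simpl; auto.
  destruct (Z.eqb_spec i j) as [->|_]; [exfalso; apply Hk; now left|].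
  rewrite Cmod_0, IH; [ring|]; intros H; apply Hk; now right.
Qed.

Lemma ple_pone : ple pone 1.
Proof.
  replace 1 with (1 + 0) by ring; apply ple_pair; [|apply l1le_zero].
  rewrite <- Cmod_1; apply l1le_delta.
Qed.

(* [jet x m n v] is the n-linear term, in [v 0 ... v (n-1)], of the expansion around [x] of the
   unnormalised product over the first [m] sites; [v j] is used at an earlier site than [v (j+1)]. *)
Fixpoint jet (x : seqZ) (m n : nat) (v : nat -> seqZ) : pseq :=
  match m with
  | O => match n with O => pone | S _ => pzero end
  | S m' =>
      padd (padd (jet x m' n v) (step m' (x (site m')) (jet x m' n v)))
           (match n with
            | O => pzero
            | S n' => step m' (v n' (site m')) (jet x m' n' v)
            end)
  end.

(** The term of degree zero of an expansion is the value at its centre, so the unnormalised product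
    itself needs no separate recursion. *)
Definition nlf (F : seqZ) (m : nat) : pseq := jet F m 0 (fun _ => F).

Lemma padd_pzero_r (p : pseq) : padd p pzero = p.
Proof. pseq_ring. Qed.

Lemma nlf_S (F : seqZ) (m : nat) :
  nlf F (S m) = padd (nlf F m) (step m (F (site m)) (nlf F m)).
Proof. unfold nlf; cbn [jet]; apply padd_pzero_r. Qed.

Lemma jet_ext (x : seqZ) (m n : nat) (v w : nat -> seqZ) :
  (forall i, (i < n)%nat -> v i = w i) -> jet x m n v = jet x m n w.
Proof.
  revert n; induction m as [|m IH]; intros n H; [reflexivity|]; cbn [jet].
  rewrite (IH n H); destruct n as [|n]; [reflexivity|].
  rewrite (IH n) by auto; rewrite H by lia; reflexivity.
Qed.

Lemma upd_eq (v : nat -> seqZ) (i : nat) (x : seqZ) : upd v i x i = x.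
Proof. unfold upd; now rewrite Nat.eqb_refl. Qed.

Lemma upd_neq (v : nat -> seqZ) (i j : nat) (x : seqZ) : j <> i -> upd v i x j = v j.
Proof. intros H; unfold upd; now destruct (Nat.eqb_spec j i). Qed.

Lemma jet_linear (x0 : seqZ) (m n : nat) (v : nat -> seqZ) (i : nat) (x y : seqZ) (a b : R) :
  (i < n)%nat ->
  jet x0 m n (upd v i (sadd (sscal a x) (sscal b y))) =
  padd (pscal a (jet x0 m n (upd v i x))) (pscal b (jet x0 m n (upd v i y))).
Proof.
  revert n; induction m as [|m IH]; intros n Hi.
  - destruct n as [|n]; [lia|]; cbn; pseq_ring.
  - cbn [jet]; rewrite (IH n Hi); destruct n as [|n]; [lia|].
    rewrite step_padd, !step_pscal; destruct (Nat.eq_dec i n) as [->|Hne].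
    (* If [i] is the last slot, the product of degree [n] does not see it, and linearity comes from
       the factor at the new site. *)
    + rewrite !upd_eq; rewrite (jet_ext x0 m n (upd v n (sadd (sscal a x) (sscal b y))) v)
        by (intros j Hj; apply upd_neq; lia).
      rewrite (jet_ext x0 m n (upd v n x) v) by (intros j Hj; apply upd_neq; lia).
      rewrite (jet_ext x0 m n (upd v n y) v) by (intros j Hj; apply upd_neq; lia).
      change (sadd (sscal a x) (sscal b y) (site m))
        with (RtoC a * x (site m) + RtoC b * y (site m))%C.
      rewrite step_plus_l, !step_scal_l; pseq_ring.
    + rewrite !(upd_neq v i n) by auto; rewrite (IH n) by lia.
      rewrite step_padd, !step_pscal; pseq_ring.
Qed.

Fixpoint mass_prod (m n : nat) (v : nat -> seqZ) : R :=
  match n with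
  | O => 1
  | S n' => mass_prod m n' v * mass (v n') m
  end.

Lemma mass_prod_ge0 (m n : nat) (v : nat -> seqZ) : 0 <= mass_prod m n v.
Proof.
  induction n as [|n IH]; simpl; [lra | apply Rmult_le_pos; auto using mass_ge0].
Qed.

Lemma mass_prod_le (m n : nat) (v : nat -> seqZ) :
  (forall j, l1 (v j)) -> mass_prod m n v <= prod_norms n v.
Proof.
  intros H; induction n as [|n IH]; simpl; [lra|].
  apply Rmult_le_compat; auto using mass_prod_ge0, mass_ge0, mass_le_l1_norm.
Qed.

Lemma mass_S (F : seqZ) (m : nat) : mass F (S m) = mass F m + Cmod (F (site m)).
Proof. reflexivity. Qed.

Lemma mass_prod_mono (m n : nat) (v : nat -> seqZ) : mass_prod m n v <= mass_prod (S m) n v.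
Proof.
  induction n as [|n IH]; simpl; [lra|].
  apply Rmult_le_compat; auto using mass_prod_ge0, mass_ge0.
  rewrite mass_S; pose proof (Cmod_ge_0 (v n (site m))); lra.
Qed.

Lemma exp_mono (a b : R) : a <= b -> exp a <= exp b.
Proof. intros [H| ->]; [left; now apply exp_increasing | right; reflexivity]. Qed.

Lemma exp_plus_ge (a b : R) : exp a * (1 + b) <= exp (a + b).
Proof.
  rewrite exp_plus; apply Rmult_le_compat_l; [left; apply exp_pos | apply exp_ineq1_le].
Qed.

(** The factor [1 + |x k|] of each site is absorbed by the exponential. The last vector acts either
    before the new site or at it, which is the passage from [mass] over [m] sites to [mass] over
    [S m] sites. *)
Lemma jet_ple (x : seqZ) (m n : nat) (v : nat -> seqZ) :
  ple (jet x m n v) (exp (mass x m) * mass_prod m n v).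
Proof.
  revert n; induction m as [|m IH]; intros n.
  - unfold mass; cbn [rsum jet]; rewrite exp_0; destruct n as [|n].
    + cbn [mass_prod]; rewrite Rmult_1_l; apply ple_pone.
    + apply ple_mono with 0; [apply ple_zero|].
      rewrite Rmult_1_l; apply mass_prod_ge0.
  - cbn [jet]; rewrite mass_S; set (u := x (site m)).
    pose proof (exp_plus_ge (mass x m) (Cmod u)) as He.
    pose proof (Cmod_ge_0 u) as Hu; pose proof (exp_pos (mass x m)) as Hp.
    pose proof (IH n) as Hn; pose proof (mass_prod_ge0 m n v) as Hq.
    pose proof (mass_prod_mono m n v) as Hmono.
    destruct n as [|n].
    + rewrite padd_pzero_r; eapply ple_mono; [apply ple_padd; [exact Hn | apply ple_step; exact Hn]|].
      cbn [mass_prod] in *; nra.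
    + eapply ple_mono; [apply ple_padd; [apply ple_padd; [exact Hn | apply ple_step; exact Hn]|];
        apply ple_step, IH|].
      cbn [mass_prod] in *; rewrite mass_S.
      pose proof (mass_prod_ge0 m n v) as Hq'; pose proof (mass_prod_mono m n v) as Hm'.
      pose proof (Cmod_ge_0 (v n (site m))) as Hv; pose proof (mass_ge0 (v n) m) as Hvm.
      set (E := exp (mass x m)) in *; set (Q := mass_prod m n v) in *.
      set (Q' := mass_prod (S m) n v) in *; set (w := Cmod (v n (site m))) in *.
      set (M := mass (v n) m) in *; set (c := Cmod u) in *.
      (* The mixed term [E * c * (Q * w)] is added: a site serves either [x] or one of the vectors,
         whereas the product of the bounds allows both. *)
      apply Rle_trans with (E * (1 + c) * (Q * (M + w))).
      * assert (0 <= E * c * (Q * w)) by (repeat apply Rmult_le_pos; lra); nra.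
      * apply Rmult_le_compat; [nra | nra | exact He | apply Rmult_le_compat_r; lra].
Qed.

Lemma jet_ple_l1 (x : seqZ) (m n : nat) (v : nat -> seqZ) :
  l1 x -> (forall j, l1 (v j)) -> ple (jet x m n v) (exp (l1_norm x) * prod_norms n v).
Proof.
  intros Hx Hv; eapply ple_mono; [apply jet_ple|].
  apply Rmult_le_compat; [left; apply exp_pos | apply mass_prod_ge0 | | now apply mass_prod_le].
  apply exp_mono, mass_le_l1_norm; auto.
Qed.

Definition jet_lim (x : seqZ) (n : nat) (v : nat -> seqZ) : pseq := plim (fun m => jet x m n v).

(** A new site changes the term by a fixed multiple of [|x|] and of the last vector at that site,
    and both are summable over the sites. *)
Lemma jet_conv (x : seqZ) (n : nat) (v : nat -> seqZ) :
  l1 x -> (forall j, l1 (v j)) -> pconv (fun m => jet x m n v) (jet_lim x n v).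
Proof.
  intros Hx Hv; destruct n as [|n].
  - apply pconv_plim with (fun m => Cmod (x (site m)) * (exp (l1_norm x) * prod_norms 0 v)).
    + intros m; cbn [jet].
      replace (psub _ _) with (step m (x (site m)) (jet x m 0 v)) by pseq_ring.
      apply ple_step, jet_ple_l1; auto.
    + apply ex_series_scal_r; now apply ex_series_site.
  - apply pconv_plim with (fun m => Cmod (x (site m)) * (exp (l1_norm x) * prod_norms (S n) v)
        + Cmod (v n (site m)) * (exp (l1_norm x) * prod_norms n v)).
    + intros m; cbn [jet].
      replace (psub _ _) with (padd (step m (x (site m)) (jet x m (S n) v))
        (step m (v n (site m)) (jet x m n v))) by pseq_ring.
      apply ple_padd; apply ple_step, jet_ple_l1; auto.
    + apply (ex_series_plus (K := R_AbsRing) (V := R_NormedModule));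
        apply ex_series_scal_r; now apply ex_series_site.
Qed.

Definition nlf_lim (F : seqZ) : pseq := jet_lim F 0 (fun _ => F).

Lemma nlf_conv (F : seqZ) : l1 F -> pconv (nlf F) (nlf_lim F).
Proof. intros H; apply jet_conv; auto. Qed.

Lemma jet_lim_ple (x : seqZ) (n : nat) (v : nat -> seqZ) :
  l1 x -> (forall j, l1 (v j)) -> ple (jet_lim x n v) (exp (l1_norm x) * prod_norms n v).
Proof.
  intros Hx Hv; eapply pconv_ple; [apply jet_conv; auto|]; intros m; now apply jet_ple_l1.
Qed.

Lemma jet_lim_ext (x : seqZ) (n : nat) (v w : nat -> seqZ) :
  (forall i, (i < n)%nat -> v i = w i) -> jet_lim x n v = jet_lim x n w.
Proof.
  intros H; unfold jet_lim; f_equal; apply functional_extensionality; intros m; now apply jet_ext.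
Qed.

Lemma l1_upd (v : nat -> seqZ) (i : nat) (x : seqZ) :
  (forall j, l1 (v j)) -> l1 x -> forall j, l1 (upd v i x j).
Proof. intros Hv Hx j; unfold upd; destruct (Nat.eqb j i); auto. Qed.

(** Both sides are limits of the same sequence, because the finite products are already
    multilinear. *)
Lemma jet_lim_linear (x0 : seqZ) (n : nat) (v : nat -> seqZ) (i : nat) (x y : seqZ) (a b : R) :
  l1 x0 -> (i < n)%nat -> (forall j, l1 (v j)) -> l1 x -> l1 y ->
  jet_lim x0 n (upd v i (sadd (sscal a x) (sscal b y))) =
  padd (pscal a (jet_lim x0 n (upd v i x))) (pscal b (jet_lim x0 n (upd v i y))).
Proof.
  intros H0 Hi Hv Hx Hy.
  apply (pconv_unique (fun m => jet x0 m n (upd v i (sadd (sscal a x) (sscal b y))))).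
  - apply jet_conv; auto; apply l1_upd; auto; apply l1_sadd; now apply l1_sscal.
  - replace (fun m => jet x0 m n (upd v i (sadd (sscal a x) (sscal b y)))) with
      (fun m => padd (pscal a (jet x0 m n (upd v i x))) (pscal b (jet x0 m n (upd v i y))))
      by (apply functional_extensionality; intros m; now rewrite jet_linear).
    apply pconv_padd; apply pconv_pscal, jet_conv; auto; now apply l1_upd.
Qed.

(** Using [h] at the new site raises the degree by one, so the last sum has one term fewer than the
    others. *)
Lemma psum_jet_S (x h : seqZ) (N m : nat) :
  psum (S N) (fun n => jet x (S m) n (fun _ => h)) =
  padd (padd (psum (S N) (fun n => jet x m n (fun _ => h)))
             (step m (x (site m)) (psum (S N) (fun n => jet x m n (fun _ => h)))))
       (step m (h (site m)) (psum N (fun n => jet x m n (fun _ => h)))).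
Proof.
  induction N as [|N IH].
  - cbn [psum jet]; rewrite step_padd, !step_pzero; pseq_ring.
  - change (psum (S (S N)) (fun n => jet x (S m) n (fun _ => h))) with
      (padd (psum (S N) (fun n => jet x (S m) n (fun _ => h))) (jet x (S m) (S N) (fun _ => h))).
    rewrite IH; cbn [psum jet]; rewrite !step_padd; pseq_ring.
Qed.

(** The remainder after [S N] terms obeys the recursion of the terms themselves: the new site lets
    [x] act on the same remainder and [h] on the full product minus the first [N] terms only. For
    [N = 0] the remainder is the product itself. *)
Lemma jet_tail (x h : seqZ) (N m : nat) :
  ple (psub (nlf (sadd x h) m) (psum N (fun n => jet x m n (fun _ => h))))
      (exp (mass x m + mass h m) * mass h m ^ N).
Proof.
  revert N; induction m as [|m IH]; intros N.
  - unfold mass; cbn [rsum]; rewrite Rplus_0_r, exp_0, Rmult_1_l.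
    replace (nlf (sadd x h) 0) with pone by reflexivity.
    destruct N as [|N].
    + cbn; replace (psub pone pzero) with pone by pseq_ring; apply ple_pone.
    + replace (psum (S N) (fun n => jet x 0 n (fun _ => h))) with pone.
      * replace (psub pone pone) with pzero by pseq_ring.
        rewrite pow_ne_zero by lia; apply ple_zero.
      * induction N as [|N IHN]; [cbn; pseq_ring|].
        change (pone = padd (psum (S N) (fun n => jet x 0 n (fun _ => h))) pzero).
        now rewrite <- IHN, padd_pzero_r.
  - rewrite nlf_S; set (s := nlf (sadd x h) m) in *.
    change (sadd x h (site m)) with (x (site m) + h (site m))%C; rewrite step_plus_l.
    rewrite !mass_S; set (X := mass x m); set (H := mass h m).
    set (a := Cmod (x (site m))); set (b := Cmod (h (site m))).
    assert (Ha : 0 <= a) by apply Cmod_ge_0; assert (Hb : 0 <= b) by apply Cmod_ge_0.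
    assert (HH : 0 <= H) by apply mass_ge0.
    assert (He : exp (X + H) * ((1 + a) * (1 + b)) <= exp (X + a + (H + b))).
    { replace (X + a + (H + b)) with (X + H + (a + b)) by ring.
      rewrite (exp_plus (X + H)), (exp_plus a b).
      apply Rmult_le_compat_l; [left; apply exp_pos|].
      apply Rmult_le_compat; try lra; apply exp_ineq1_le. }
    pose proof (exp_pos (X + H)) as Hp.
    destruct N as [|N].
    + pose proof (IH O) as I0; cbn [psum pow] in *; fold X H in I0.
      replace (psub s pzero) with s in I0 by pseq_ring.
      replace (psub _ _) with
        (padd s (padd (step m (x (site m)) s) (step m (h (site m)) s))) by pseq_ring.
      eapply ple_mono; [apply ple_padd; [exact I0 | apply ple_padd; apply ple_step; exact I0]|].
      fold a b; rewrite !Rmult_1_r.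
      assert (0 <= exp (X + H) * (a * b)) by (repeat apply Rmult_le_pos; lra); lra.
    + rewrite psum_jet_S.
      pose proof (IH (S N)) as I1; pose proof (IH N) as I0; fold X H in I0, I1.
      set (t1 := psum (S N) (fun n => jet x m n (fun _ => h))) in *.
      set (t0 := psum N (fun n => jet x m n (fun _ => h))) in *.
      (* The factor at the new site is split as [1 + x + h]; the part with [h] meets the truncation
         [t0], which is shorter by one degree. *)
      replace (psub _ _) with
        (padd (padd (psub s t1) (step m (x (site m)) (psub s t1))) (step m (h (site m)) (psub s t0)))
        by (rewrite !step_psub; pseq_ring).
      eapply ple_mono; [apply ple_padd; [apply ple_padd; [exact I1 | apply ple_step; exact I1]|];
        apply ple_step; exact I0|].
      fold a b; simpl pow.
      assert (HN : H ^ N <= (H + b) ^ N) by (apply pow_incr; lra).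
      assert (HN0 : 0 <= H ^ N) by now apply pow_le.
      set (P := H ^ N) in *; set (E := exp (X + H)) in *.
      apply Rle_trans with (E * ((1 + a) * (1 + b)) * ((H + b) * P)).
      * assert (E * b * P <= E * ((1 + a) * (1 + b)) * (b * P)).
        { replace (E * b * P) with (E * (b * P) * 1) by ring.
          replace (E * ((1 + a) * (1 + b)) * (b * P)) with (E * (b * P) * ((1 + a) * (1 + b))) by ring.
          apply Rmult_le_compat_l; [|nra]; repeat apply Rmult_le_pos; lra. }
        assert (E * (H * P) * (1 + a) <= E * ((1 + a) * (1 + b)) * (H * P)).
        { replace (E * ((1 + a) * (1 + b)) * (H * P)) with (E * (H * P) * ((1 + a) * (1 + b))) by ring.
          apply Rmult_le_compat_l; [|nra]; repeat apply Rmult_le_pos; lra. }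
        lra.
      * apply Rmult_le_compat; [| |exact He|apply Rmult_le_compat_l; lra];
          repeat apply Rmult_le_pos; lra.
Qed.

Lemma jet_lim_tail (x h : seqZ) (N : nat) :
  l1 x -> l1 h ->
  ple (psub (nlf_lim (sadd x h)) (psum N (fun n => jet_lim x n (fun _ => h))))
      (exp (l1_norm x + l1_norm h) * l1_norm h ^ N).
Proof.
  intros Hx Hh.
  apply (pconv_ple (fun m => psub (nlf (sadd x h) m) (psum N (fun n => jet x m n (fun _ => h))))).
  - apply pconv_psub; [apply nlf_conv; now apply l1_sadd|].
    apply (pconv_psum N (fun n m => jet x m n (fun _ => h))).
    intros n; apply jet_conv; auto.
  - intros m; eapply ple_mono; [apply jet_tail|].
    pose proof (mass_le_l1_norm x m Hx); pose proof (mass_le_l1_norm h m Hh).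
    pose proof (mass_ge0 h m).
    apply Rmult_le_compat; [left; apply exp_pos | now apply pow_le | apply exp_mono; lra |
      apply pow_incr; lra].
Qed.

(** * The binomial series of the inverse square root *)

(** The binomial coefficients of [-1/2] over [m], that is, the Taylor coefficients of
    [(1 + x)^(-1/2)]. *)
Fixpoint binom_coef (m : nat) : R :=
  match m with
  | O => 1
  | S m' => - binom_coef m' * ((2 * INR m' + 1) / (2 * INR m' + 2))
  end.

Lemma Rabs_binom_coef_le (m : nat) : Rabs (binom_coef m) <= 1.
Proof.
  induction m as [|m IH]; [simpl; rewrite Rabs_R1; lra|].
  cbn [binom_coef]; rewrite Rabs_mult, Rabs_Ropp; pose proof (pos_INR m) as Hm.
  assert (H : 0 <= (2 * INR m + 1) / (2 * INR m + 2) <= 1).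
  { split; [apply Rdiv_le_0_compat; lra | apply Rle_div_l; lra]. }
  rewrite (Rabs_pos_eq (_ / _)) by tauto; pose proof (Rabs_pos (binom_coef m)); nra.
Qed.

Lemma binom_coef_radius (x : R) : Rabs x < 1 -> Rbar_lt (Rabs x) (CV_radius binom_coef).
Proof.
  intros Hx; apply Rbar_lt_le_trans with 1; [exact Hx|].
  apply (proj1 (CV_radius_bounded binom_coef)); exists 1; intros n.
  rewrite pow1, Rmult_1_r; apply Rabs_binom_coef_le.
Qed.

(** This is the differential equation of [(1 + x)^(-1/2)]; coefficient by coefficient it is the
    recursion of [binom_coef]. *)
Lemma binom_series_ode (x : R) :
  Rabs x < 1 ->
  2 * (1 + x) * PSeries (PS_derive binom_coef) x = - PSeries binom_coef x.
Proof.
  intros Hx; pose proof (binom_coef_radius x Hx) as Hr.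
  assert (E0 : ex_pseries binom_coef x) by (apply CV_radius_inside; exact Hr).
  assert (E1 : ex_pseries (PS_derive binom_coef) x)
    by (apply CV_radius_inside; rewrite CV_radius_derive; exact Hr).
  assert (E2 : ex_pseries (PS_incr_1 (PS_derive binom_coef)) x) by now apply ex_pseries_incr_1.
  assert (H : PSeries (PS_plus (PS_scal 2 (PS_plus (PS_derive binom_coef)
                (PS_incr_1 (PS_derive binom_coef)))) binom_coef) x = 0).
  { transitivity (PSeries (fun _ => 0) x); [|apply PSeries_const_0].
    apply PSeries_ext; intros n; unfold PS_plus, PS_scal, PS_incr_1, PS_derive.
    change plus with Rplus; change (@scal _ R_ModuleSpace) with Rmult.
    destruct n as [|n].
    - cbn; unfold plus, scal, mult; cbn; field.
    - unfold plus, scal, zero, mult; cbn -[INR binom_coef].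
      change (binom_coef (S (S n))) with
        (- binom_coef (S n) * ((2 * INR (S n) + 1) / (2 * INR (S n) + 2))).
      rewrite (S_INR (S n)); pose proof (pos_INR (S n)); field; lra. }
  assert (E3 : ex_pseries (PS_plus (PS_derive binom_coef) (PS_incr_1 (PS_derive binom_coef))) x)
    by now apply ex_pseries_plus.
  rewrite PSeries_plus in H; [|apply ex_pseries_scal; auto; apply Rmult_comm | exact E0].
  rewrite PSeries_scal, PSeries_plus, PSeries_incr_1 in H by auto; lra.
Qed.

(** The coefficients are bounded by 1, so a geometric series dominates the tail; its sum is at most
    2 when [|x| <= 1 / 2]. *)
Lemma binom_series_tail (x : R) (N : nat) :
  Rabs x <= / 2 ->
  Rabs (PSeries binom_coef x - rsum N (fun m => binom_coef m * x ^ m)) <= 2 * Rabs x ^ N.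
Proof.
  intros Hx.
  assert (Hq : Rabs x < 1) by lra.
  assert (Hg : ex_series (fun k => Rabs x ^ k)).
  { apply ex_series_geom; rewrite Rabs_Rabsolu; exact Hq. }
  assert (Hb : forall k, Rabs (binom_coef k * x ^ k) <= Rabs x ^ k).
  { intros k; rewrite Rabs_mult, RPow_abs; pose proof (Rabs_binom_coef_le k).
    pose proof (Rabs_pos (x ^ k)); nra. }
  assert (Ha : ex_series (fun k => Rabs (binom_coef k * x ^ k))).
  { apply (ex_series_le (K := R_AbsRing) (V := R_CompleteNormedModule)) with (fun k => Rabs x ^ k); auto.
    intros n; change norm with Rabs; rewrite Rabs_Rabsolu; apply Hb. }
  assert (Hs : Series (fun k => Rabs x ^ k) <= 2).
  { rewrite Series_geom by (rewrite Rabs_Rabsolu; exact Hq).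
    replace 2 with (/ / 2) by field; apply Rinv_le_contravar; lra. }
  assert (E : PSeries binom_coef x - rsum N (fun m => binom_coef m * x ^ m)
              = Series (fun k => binom_coef (N + k) * x ^ (N + k))).
  { unfold PSeries; destruct N as [|N].
    - simpl; ring.
    - rewrite (Series_incr_n (fun k => binom_coef k * x ^ k) (S N)); [|lia|now apply ex_series_Rabs].
      rewrite <- sum_n_Reals, sum_n_rsum; simpl pred; ring. }
  rewrite E.
  assert (HaN : ex_series (fun k => Rabs (binom_coef (N + k) * x ^ (N + k)))).
  { apply (ex_series_incr_n (fun k => Rabs (binom_coef k * x ^ k)) N); exact Ha. }
  eapply Rle_trans; [now apply Series_Rabs|].
  apply Rle_trans with (Series (fun k => Rabs x ^ N * Rabs x ^ k)).
  - apply Series_le; [|now apply (ex_series_scal (K := R_AbsRing) (V := R_NormedModule))].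
    intros k; split; [apply Rabs_pos|]; rewrite <- pow_add; apply Hb.
  - rewrite Series_scal_l, Rmult_comm; apply Rmult_le_compat_r; auto.
    apply pow_le, Rabs_pos.
Qed.

(** By the differential equation the left side has derivative zero on the unit interval around zero,
    and its value at zero is 1. *)
Lemma binom_series_sqr (x : R) : Rabs x < 1 -> PSeries binom_coef x ^ 2 * (1 + x) = 1.
Proof.
  intros Hx; set (g := fun t => PSeries binom_coef t ^ 2 * (1 + t)).
  assert (Hg : forall t, Rabs t < 1 -> is_derive g t 0).
  { intros t Ht; pose proof (is_derive_PSeries _ _ (binom_coef_radius t Ht)) as Hd.
    pose proof (binom_series_ode t Ht) as Ho.
    unfold g; evar_last.
    - apply (is_derive_mult (fun t => PSeries binom_coef t ^ 2) (fun t => 1 + t)).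
      + apply is_derive_pow; exact Hd.
      + apply (is_derive_plus (fun _ => 1) (fun t => t)); [apply is_derive_const | apply is_derive_id].
      + intros; apply Rmult_comm.
    - unfold plus, mult, zero, one; cbn; nra. }
  assert (G0 : g 0 = 1).
  { unfold g; rewrite PSeries_0; simpl; ring. }
  change (g x = 1); rewrite <- G0; apply Rabs_def2 in Hx.
  destruct (Rtotal_order x 0) as [H|[->|H]]; [|reflexivity|].
  - apply (eq_is_derive g x 0); auto; intros t Ht; apply Hg, Rabs_def1; lra.
  - symmetry; apply (eq_is_derive g 0 x); auto; intros t Ht; apply Hg, Rabs_def1; lra.
Qed.

(** The square is known, so only the sign remains: the tail estimate after one term puts the series
    within [2 |x| <= 1 / 2] of 1, hence it is positive. *)
Lemma binom_series (x : R) : Rabs x <= / 4 -> PSeries binom_coef x = / sqrt (1 + x).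
Proof.
  intros Hx; assert (H1 : Rabs x < 1) by lra.
  pose proof (binom_series_sqr x H1) as Hs.
  assert (Ht := binom_series_tail x 1 ltac:(lra)); simpl in Ht.
  set (f := PSeries binom_coef x) in *.
  assert (Hf : 0 < f) by (apply Rabs_le_between in Ht; lra).
  apply Rabs_le_between in Hx.
  rewrite <- (sqrt_pow2 f) by lra; rewrite <- sqrt_inv; f_equal.
  apply Rmult_eq_reg_r with (1 + x); [|lra]; rewrite Hs; field; lra.
Qed.

(** * Expansions with geometric bounds *)

Definition shiftv (i : nat) (v : nat -> seqZ) : nat -> seqZ := fun j => v (i + j)%nat.

Lemma prod_norms_shiftv (n i : nat) (v : nat -> seqZ) :
  (i <= n)%nat -> prod_norms n v = prod_norms i v * prod_norms (n - i) (shiftv i v).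
Proof.
  intros H; replace n with (i + (n - i))%nat at 1 by lia; generalize (n - i)%nat as k; clear.
  induction k as [|k IH]; [rewrite Nat.add_0_r; simpl; ring|].
  rewrite Nat.add_succ_r; simpl; rewrite IH; unfold shiftv; ring.
Qed.

Lemma prod_norms_const (n : nat) (h : seqZ) : prod_norms n (fun _ => h) = l1_norm h ^ n.
Proof. induction n as [|n IH]; simpl; [ring | rewrite IH; ring]. Qed.

(* Values in a vector space are represented by their families of real coordinates, indexed by [X],
   and a norm by the predicate [B x K] that [x] has norm at most [K]. *)
Record is_ball {X : Type} (B : (X -> R) -> R -> Prop) : Prop := {
  ball_add : forall x y a b, B x a -> B y b -> B (fun t => x t + y t) (a + b);
  ball_scal : forall c x a, B x a -> B (fun t => c * x t) (Rabs c * a);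
  ball_mono : forall x a b, B x a -> a <= b -> B x b;
  ball_zero : B (fun _ => 0) 0 }.

Definition multilinear {X : Type} (n : nat) (A : (nat -> seqZ) -> X -> R) : Prop :=
  (forall v w, (forall i, (i < n)%nat -> v i = w i) -> A v = A w) /\
  (forall v i x y a b t, (i < n)%nat -> (forall j, l1 (v j)) -> l1 x -> l1 y ->
     A (upd v i (sadd (sscal a x) (sscal b y))) t = a * A (upd v i x) t + b * A (upd v i y) t).

(** An expansion of [f] at zero with constant [K] and rate [D]. The remainder is controlled for
    every [N] on the closed ball [D |h| <= 1]; [N = 0] bounds [f] itself there. *)
Record geometric {X : Type} (B : (X -> R) -> R -> Prop) (f : seqZ -> X -> R)
    (A : nat -> (nat -> seqZ) -> X -> R) (K D : R) : Prop := {
  geo_lin : forall n, multilinear n (A n);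
  geo_bound : forall n v, (forall j, l1 (v j)) -> B (A n v) (K * D ^ n * prod_norms n v);
  geo_tail : forall h N, l1 h -> D * l1_norm h <= 1 ->
    B (fun t => f h t - rsum N (fun n => A n (fun _ => h) t)) (K * (D * l1_norm h) ^ N) }.

(** Scalars are families indexed by [unit], so that scalar and pair-valued expansions share one
    calculus. *)
Definition Rball (x : unit -> R) (K : R) : Prop := Rabs (x tt) <= K.

Lemma is_ball_Rball : is_ball Rball.
Proof.
  unfold Rball; constructor.
  - intros x y a b Ha Hb; eapply Rle_trans; [apply Rabs_triang | lra].
  - intros c x a Ha; rewrite Rabs_mult; apply Rmult_le_compat_l; auto using Rabs_pos.
  - intros; lra.
  - rewrite Rabs_R0; lra.
Qed.

Section Operations.

Context {X : Type} (B : (X -> R) -> R -> Prop) (HB : is_ball B).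

Lemma ball_ext (x y : X -> R) (a b : R) : B x a -> (forall t, x t = y t) -> a <= b -> B y b.
Proof.
  intros Hx Hxy Hab; replace y with x by (apply functional_extensionality; auto).
  eapply ball_mono; eauto.
Qed.

Lemma ball_scal_le (c : R) (x : X -> R) (a b : R) :
  Rabs c <= b -> 0 <= a -> B x a -> B (fun t => c * x t) (b * a).
Proof.
  intros Hc Ha Hx; apply ball_mono with (Rabs c * a); auto; [now apply ball_scal|].
  now apply Rmult_le_compat_r.
Qed.

Lemma ball_rsum (N : nat) (x : nat -> X -> R) (c : nat -> R) :
  (forall i, (i < N)%nat -> B (x i) (c i)) ->
  B (fun t => rsum N (fun i => x i t)) (rsum N c).
Proof.
  induction N as [|N IH]; intros H; simpl; [exact (ball_zero _ HB)|].
  apply (ball_add _ HB (fun t => rsum N (fun i => x i t))); auto.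
Qed.

Lemma multilinear_rsum (n N : nat) (A : nat -> (nat -> seqZ) -> X -> R) :
  (forall i, (i < N)%nat -> multilinear n (A i)) ->
  multilinear n (fun v t => rsum N (fun i => A i v t)).
Proof.
  intros H; split.
  - intros v w Hvw; apply functional_extensionality; intros t; apply rsum_ext; intros i Hi.
    now rewrite (proj1 (H i Hi) v w Hvw).
  - intros v i x y a b t Hi Hv Hx Hy; rewrite <- !rsum_scal, <- rsum_plus.
    apply rsum_ext; intros k Hk; now apply (proj2 (H k Hk)).
Qed.

Lemma multilinear_scal (n : nat) (c : R) (A : (nat -> seqZ) -> X -> R) :
  multilinear n A -> multilinear n (fun v t => c * A v t).
Proof.
  intros [H1 H2]; split.
  - intros v w Hvw; now rewrite (H1 v w Hvw).
  - intros v i x y a b t Hi Hv Hx Hy; rewrite H2 by auto; ring.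
Qed.

Lemma multilinear_tensor (n i : nat) (A : (nat -> seqZ) -> unit -> R) (S : (nat -> seqZ) -> X -> R) :
  (i <= n)%nat -> multilinear i A -> multilinear (n - i) S ->
  multilinear n (fun v t => A v tt * S (shiftv i v) t).
Proof.
  intros Hin [A1 A2] [S1 S2]; split.
  - intros v w Hvw; rewrite (A1 v w) by (intros; apply Hvw; lia).
    rewrite (S1 (shiftv i v) (shiftv i w)); [reflexivity|].
    intros j Hj; apply Hvw; lia.
  - intros v j x y a b t Hj Hv Hx Hy; destruct (Nat.lt_ge_cases j i) as [Hji|Hji].
    + assert (E : forall z, S (shiftv i (upd v j z)) = S (shiftv i v)).
      { intros z; apply S1; intros k Hk; unfold shiftv, upd; destruct (Nat.eqb_spec (i + k) j); [lia | reflexivity]. }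
      rewrite A2, !E by auto; ring.
    + assert (E : forall z, A (upd v j z) = A v).
      { intros z; apply A1; intros k Hk; unfold upd; destruct (Nat.eqb_spec k j); [lia | reflexivity]. }
      assert (E' : forall z, S (shiftv i (upd v j z)) = S (upd (shiftv i v) (j - i) z)).
      { intros z; apply S1; intros k Hk; unfold shiftv, upd.
        destruct (Nat.eqb_spec (i + k) j), (Nat.eqb_spec k (j - i)); auto; lia. }
      rewrite !E, !E', S2; [ring | lia | | auto | auto]; intros k; apply Hv.
Qed.

(** The first [i] vectors go to the scalar term and the remaining ones to the other; the result is
    multilinear but not symmetrised. *)
Definition cauchy_prod (A : nat -> (nat -> seqZ) -> unit -> R) (S : nat -> (nat -> seqZ) -> X -> R)
    (n : nat) (v : nat -> seqZ) (t : X) : R :=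
  rsum (n + 1) (fun i => A i v tt * S (n - i)%nat (shiftv i v) t).

Lemma rsum_cauchy (N : nat) (a s : nat -> R) :
  rsum N (fun n => rsum (n + 1) (fun i => a i * s (n - i)%nat)) =
  rsum N (fun i => a i * rsum (N - i) s).
Proof.
  induction N as [|N IH]; [reflexivity|].
  change (rsum (S N) (fun i => a i * rsum (S N - i) s)) with
    (rsum N (fun i => a i * rsum (S N - i) s) + a N * rsum (S N - N) s).
  rewrite (rsum_ext N (fun i => a i * rsum (S N - i) s)
    (fun i => a i * rsum (N - i) s + a i * s (N - i)%nat)).
  - rewrite rsum_plus, <- IH; cbn [rsum]; rewrite Nat.add_1_r; cbn [rsum].
    replace (S N - N)%nat with 1%nat by lia; rewrite Nat.sub_diag; cbn [rsum]; ring.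
  - intros n Hn; replace (S N - n)%nat with (S (N - n)) by lia; cbn [rsum]; ring.
Qed.

Lemma rsum_pow2 (N : nat) : rsum N (fun i => 2 ^ (N - i)) = 2 * 2 ^ N - 2.
Proof.
  induction N as [|N IH]; [simpl; ring|].
  cbn [rsum]; rewrite (rsum_ext N _ (fun i => 2 * 2 ^ (N - i))).
  - rewrite rsum_scal, IH; replace (S N - N)%nat with 1%nat by lia; simpl; ring.
  - intros n Hn; replace (S N - n)%nat with (S (N - n)) by lia; reflexivity.
Qed.

(* Doubling the rate in the second factor turns the sum of the [2 ^ (n - i)] into a constant
   factor 2, so that powers can be iterated without degrading the rate. *)
Lemma geometric_mult (f : seqZ -> unit -> R) (g : seqZ -> X -> R) A S (K1 K2 D : R) :
  0 <= K1 -> 0 <= K2 -> 0 <= D ->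
  geometric Rball f A K1 D -> geometric B g S K2 (2 * D) ->
  geometric B (fun h t => f h tt * g h t) (cauchy_prod A S) (2 * (K1 * K2)) (2 * D).
Proof.
  intros HK1 HK2 HD [A1 A2 A3] [S1 S2 S3]; constructor.
  - intros n; apply multilinear_rsum; intros i Hi; apply multilinear_tensor; auto; lia.
  - intros n v Hv; unfold cauchy_prod.
    assert (Hv' : forall i j, l1 (shiftv i v j)) by (intros i j; apply Hv).
    assert (Hp : forall n v, (forall j, l1 (v j)) -> 0 <= prod_norms n v).
    { intros k w Hw; apply prod_norms_ge0; intros j; now apply l1_norm_ge0. }
    assert (Hterm : forall i, (i < n + 1)%nat -> B (fun t => A i v tt * S (n - i)%nat (shiftv i v) t)
      (K1 * D ^ i * prod_norms i v * (K2 * (2 * D) ^ (n - i) * prod_norms (n - i) (shiftv i v)))).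
    { intros i _; apply ball_scal_le; [now apply A2 | | now apply S2].
      apply Rmult_le_pos; [apply Rmult_le_pos; [auto | apply pow_le; lra] | auto]. }
    eapply ball_mono; [exact HB | exact (ball_rsum _ _ _ Hterm)|].
    rewrite (rsum_ext _ _ (fun i => K1 * K2 * D ^ n * prod_norms n v * 2 ^ (n - i))).
    + rewrite rsum_scal, Nat.add_1_r; cbn [rsum]; rewrite rsum_pow2, Nat.sub_diag, Rpow_mult_distr.
      assert (0 <= K1 * K2 * D ^ n * prod_norms n v)
        by (repeat apply Rmult_le_pos; auto using pow_le).
      simpl; nra.
    + intros i Hi; rewrite (prod_norms_shiftv n i v) by lia; rewrite Rpow_mult_distr.
      replace (D ^ n) with (D ^ i * D ^ (n - i)) by (rewrite <- pow_add; f_equal; lia); ring.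
  - intros h N Hh Hr; set (rho := l1_norm h) in *.
    assert (Hrho : 0 <= rho) by now apply l1_norm_ge0.
    assert (H0 : 0 <= D * rho) by now apply Rmult_le_pos.
    (* The remainder after zero terms is [g h] itself. *)
    assert (Hg : B (g h) K2).
    { eapply ball_ext; [exact (S3 h O Hh Hr) | intros t; simpl; ring | simpl; lra]. }
    assert (Hf : Rabs (f h tt - rsum N (fun n => A n (fun _ => h) tt)) <= K1 * (D * rho) ^ N)
      by (apply A3; auto; fold rho; lra).
    assert (Ha : forall i, Rabs (A i (fun _ => h) tt) <= K1 * (D * rho) ^ i).
    { intros i; eapply Rle_trans; [apply A2; auto|].
      rewrite prod_norms_const, Rpow_mult_distr; fold rho; lra. }
    assert (Hterm : forall i, (i < N)%nat ->
      B (fun t => A i (fun _ => h) tt * (g h t - rsum (N - i) (fun n => S n (fun _ => h) t)))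
        (K1 * (D * rho) ^ i * (K2 * (2 * D * rho) ^ (N - i)))).
    { intros i _; apply ball_scal_le; [apply Ha | | now apply S3].
      apply Rmult_le_pos; [auto | apply pow_le; lra]. }
    assert (Hsum := ball_rsum _ _ _ Hterm).
    (* The remainder of the product is the remainder of [f] times [g], plus, for each [i < N], the
       term of [f] of degree [i] times the remainder of [g] after [N - i] terms. *)
    assert (Hall := ball_add _ HB _ _ _ _ (ball_scal_le _ _ _ _ Hf HK2 Hg) Hsum).
    eapply ball_ext; [exact Hall | |].
    + intros t; cbn beta; unfold cauchy_prod.
      rewrite (rsum_ext N (fun n => rsum (n + 1) _)
        (fun n => rsum (n + 1) (fun i => A i (fun _ => h) tt * S (n - i)%nat (fun _ => h) t))) by reflexivity.
      rewrite (rsum_cauchy N (fun i => A i (fun _ => h) tt) (fun n => S n (fun _ => h) t)).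
      rewrite (rsum_ext N (fun i => A i (fun _ => h) tt * (g h t - _))
        (fun i => g h t * A i (fun _ => h) tt +
           (-1) * (A i (fun _ => h) tt * rsum (N - i) (fun n => S n (fun _ => h) t)))).
      * rewrite rsum_plus, !rsum_scal; ring.
      * intros i Hi; ring.
    + fold rho; rewrite (rsum_ext N _ (fun i => K1 * K2 * (D * rho) ^ N * 2 ^ (N - i))).
      * rewrite rsum_scal, rsum_pow2.
        replace (2 * D * rho) with (2 * (D * rho)) by ring; rewrite (Rpow_mult_distr 2).
        assert (0 <= K1 * K2 * (D * rho) ^ N) by (repeat apply Rmult_le_pos; auto using pow_le).
        nra.
      * intros i Hi; replace (2 * D * rho) with (2 * (D * rho)) by ring.
        replace ((D * rho) ^ N) with ((D * rho) ^ i * (D * rho) ^ (N - i))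
          by (rewrite <- pow_add; f_equal; lia).
        rewrite (Rpow_mult_distr 2); ring.
Qed.

Lemma geometric_mono (f : seqZ -> X -> R) A (K D K' D' : R) :
  0 <= K -> 0 <= D -> K <= K' -> D <= D' -> geometric B f A K D -> geometric B f A K' D'.
Proof.
  intros HK HD HK' HD' [A1 A2 A3]; constructor; auto.
  - intros n v Hv; eapply ball_mono; auto.
    apply Rmult_le_compat_r; [apply prod_norms_ge0; intros; now apply l1_norm_ge0|].
    apply Rmult_le_compat; auto; [now apply pow_le | now apply pow_incr].
  - intros h N Hh Hr; pose proof (l1_norm_ge0 h Hh).
    assert (D * l1_norm h <= D' * l1_norm h) by now apply Rmult_le_compat_r.
    assert (0 <= D * l1_norm h) by now apply Rmult_le_pos.
    eapply ball_mono; [auto | apply A3; auto; lra|].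
    apply Rmult_le_compat; auto; [now apply pow_le | now apply pow_incr].
Qed.

Lemma geometric_plus (f g : seqZ -> X -> R) A S (K1 K2 D : R) :
  geometric B f A K1 D -> geometric B g S K2 D ->
  geometric B (fun h t => f h t + g h t) (fun n v t => A n v t + S n v t) (K1 + K2) D.
Proof.
  intros [A1 A2 A3] [S1 S2 S3]; constructor.
  - intros n; split.
    + intros v w Hvw; now rewrite (proj1 (A1 n) v w Hvw), (proj1 (S1 n) v w Hvw).
    + intros v i x y a b t Hi Hv Hx Hy.
      rewrite (proj2 (A1 n)), (proj2 (S1 n)) by auto; ring.
  - intros n v Hv; eapply ball_ext;
      [apply (ball_add _ HB _ _ _ _ (A2 n v Hv) (S2 n v Hv)) | reflexivity | right; ring].
  - intros h N Hh Hr; eapply ball_ext;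
      [apply (ball_add _ HB _ _ _ _ (A3 h N Hh Hr) (S3 h N Hh Hr)) | | right; ring].
    intros t; cbn beta; rewrite rsum_plus; ring.
Qed.

Lemma geometric_scal (c : R) (f : seqZ -> X -> R) A (K D : R) :
  geometric B f A K D ->
  geometric B (fun h t => c * f h t) (fun n v t => c * A n v t) (Rabs c * K) D.
Proof.
  intros [A1 A2 A3]; constructor.
  - intros n; now apply multilinear_scal.
  - intros n v Hv; eapply ball_ext; [apply (ball_scal _ HB c _ _ (A2 n v Hv)) | reflexivity | right; ring].
  - intros h N Hh Hr; eapply ball_ext; [apply (ball_scal _ HB c _ _ (A3 h N Hh Hr)) | | right; ring].
    intros t; cbn beta; rewrite rsum_scal; ring.
Qed.

End Operations.

Lemma geometric_one (D : R) :
  0 <= D -> geometric Rball (fun _ _ => 1) (fun n _ _ => if Nat.eqb n 0 then 1 else 0) 1 D.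
Proof.
  intros HD; constructor; unfold Rball.
  - intros n; split; [reflexivity|]; intros v i x y a b t Hi _ _ _.
    destruct (Nat.eqb_spec n 0); [lia | ring].
  - intros n v Hv; destruct (Nat.eqb_spec n 0) as [->|Hn].
    + simpl; rewrite Rabs_R1; lra.
    + rewrite Rabs_R0; repeat apply Rmult_le_pos; try lra; [now apply pow_le|].
      apply prod_norms_ge0; intros; now apply l1_norm_ge0.
  - intros h N Hh Hr; destruct N as [|N]; [simpl; rewrite Rminus_0_r, Rabs_R1; lra|].
    replace (rsum (S N) (fun n => if Nat.eqb n 0 then 1 else 0)) with 1.
    + rewrite Rminus_diag, Rabs_R0, Rmult_1_l; apply pow_le, Rmult_le_pos; auto.
      now apply l1_norm_ge0.
    + induction N as [|N IH]; [simpl; ring|].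
      change (1 = rsum (S N) (fun n => if Nat.eqb n 0 then 1 else 0) + 0); rewrite <- IH; ring.
Qed.

Fixpoint cauchy_pow (W : nat -> (nat -> seqZ) -> unit -> R) (m : nat) :
    nat -> (nat -> seqZ) -> unit -> R :=
  match m with
  | O => fun n _ _ => if Nat.eqb n 0 then 1 else 0
  | S m' => cauchy_prod W (cauchy_pow W m')
  end.

(** Each multiplication pairs a factor of rate [D] with a power of rate [2 * D], so only the
    constant grows with [m]. *)
Lemma geometric_pow (w : seqZ -> R) W (K D : R) (m : nat) :
  0 <= K -> 0 <= D -> geometric Rball (fun h _ => w h) W K D ->
  geometric Rball (fun h _ => w h ^ m) (cauchy_pow W m) ((2 * K) ^ m) (2 * D).
Proof.
  intros HK HD HW; induction m as [|m IH]; [apply geometric_one; lra|].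
  replace ((2 * K) ^ S m) with (2 * (K * (2 * K) ^ m)) by (simpl; ring).
  apply (geometric_mult Rball is_ball_Rball (fun h _ => w h) (fun h _ => w h ^ m)); auto.
  apply pow_le; lra.
Qed.

(** Without a constant term every factor raises the degree by at least one. Hence only the powers up
    to [n] contribute to degree [n] of a composed series. *)
Lemma cauchy_pow_low (W : nat -> (nat -> seqZ) -> unit -> R) (m n : nat) (v : nat -> seqZ) (t : unit) :
  (forall v, W O v tt = 0) -> (n < m)%nat -> cauchy_pow W m n v t = 0.
Proof.
  intros H0; revert n v t; induction m as [|m IH]; intros n v t Hn; [lia|].
  cbn [cauchy_pow]; unfold cauchy_prod.
  rewrite (rsum_ext _ _ (fun _ => 0)); [rewrite rsum_const; ring|].
  intros [|i] Hi; [rewrite H0; ring | rewrite IH by lia; ring].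
Qed.

Lemma rsum_extend0 (N M : nat) (f : nat -> R) :
  (N <= M)%nat -> (forall n, (N <= n < M)%nat -> f n = 0) -> rsum M f = rsum N f.
Proof.
  intros H; induction H as [|M H IH]; intros Hf; [reflexivity|].
  cbn [rsum]; rewrite IH, Hf; [ring | lia | intros; apply Hf; lia].
Qed.

Lemma rsum_exchange (N M : nat) (f : nat -> nat -> R) :
  rsum N (fun n => rsum M (fun m => f n m)) = rsum M (fun m => rsum N (fun n => f n m)).
Proof.
  induction N as [|N IH]; simpl; [rewrite rsum_const; ring | rewrite IH, <- rsum_plus; reflexivity].
Qed.

Lemma INR_le_pow2 (n : nat) : INR n + 1 <= 2 ^ n.
Proof.
  induction n as [|n IH]; [simpl; lra|].
  rewrite S_INR; simpl; pose proof (pos_INR n); lra.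
Qed.

(** In degree [n] only powers [m <= n] occur, and [K >= 1] bounds their constants [(2 K)^m] by
    [(2 K)^n], which moves them into the rate. The number of powers costs a further [2^n], giving
    the rate [2 * 2 K * 2 D]. The constant 3 adds 2 from the tail of the binomial series and 1 from
    the remainders of the powers. *)
Lemma geometric_invsqrt (w : seqZ -> R) W (K D : R) :
  1 <= K -> 0 <= D -> (forall v, W O v tt = 0) ->
  geometric Rball (fun h _ => w h) W K D ->
  geometric Rball (fun h _ => / sqrt (1 + w h))
    (fun n v t => rsum (n + 1) (fun m => binom_coef m * cauchy_pow W m n v t)) 3 (8 * K * D).
Proof.
  intros HK HD H0 HW.
  assert (HP := fun m => geometric_pow w W K D m ltac:(lra) HD HW).
  assert (HKm : forall m n, (m <= n)%nat -> (2 * K) ^ m <= (2 * K) ^ n)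
    by (intros m n Hmn; apply Rle_pow; [lra | auto]).
  constructor.
  - intros n; apply multilinear_rsum; intros i _; apply multilinear_scal, (HP i).
  - intros n v Hv; unfold Rball.
    assert (Hp : 0 <= prod_norms n v) by (apply prod_norms_ge0; intros; now apply l1_norm_ge0).
    eapply Rle_trans; [apply Rabs_rsum_le|].
    apply Rle_trans with (rsum (n + 1) (fun _ => (2 * K) ^ n * (2 * D) ^ n * prod_norms n v)).
    + apply rsum_le; intros m Hm; rewrite Rabs_mult.
      assert (Hb := geo_bound _ _ _ _ _ (HP m) n v Hv); unfold Rball in Hb.
      assert (Hc := Rabs_binom_coef_le m); assert (Hk := HKm m n ltac:(lia)).
      apply Rle_trans with (Rabs (cauchy_pow W m n v tt));
        [pose proof (Rabs_pos (cauchy_pow W m n v tt)); nra|].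
      eapply Rle_trans; [exact Hb|]; apply Rmult_le_compat_r; auto.
      apply Rmult_le_compat_r; auto; apply pow_le; lra.
    + rewrite rsum_const; replace (8 * K * D) with (2 * ((2 * K) * (2 * D))) by ring.
      rewrite !Rpow_mult_distr, plus_INR; pose proof (INR_le_pow2 n) as Hn; simpl (INR 1).
      set (Q := 2 ^ n * K ^ n * (2 ^ n * D ^ n) * prod_norms n v).
      assert (HQ : 0 <= Q).
      { unfold Q; repeat apply Rmult_le_pos; auto; apply pow_le; lra. }
      replace (3 * (2 ^ n * (2 ^ n * K ^ n * (2 ^ n * D ^ n))) * prod_norms n v)
        with (3 * (2 ^ n * Q)) by (unfold Q; ring).
      fold Q; pose proof (pos_INR n); nra.
  - intros h N Hh Hr; unfold Rball; set (rho := l1_norm h) in *.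
    assert (Hrho : 0 <= rho) by now apply l1_norm_ge0.
    assert (HDr : 0 <= D * rho) by now apply Rmult_le_pos.
    (* The rate [8 * K * D] keeps [|w h|] at most [1 / 8], inside the range where the binomial
       series equals the inverse square root. *)
    assert (HKD : 0 <= K * (D * rho) <= / 8) by (split; [apply Rmult_le_pos; lra | lra]).
    assert (HD2 : 2 * D * rho <= 1) by nra.
    assert (Hw : Rabs (w h) <= K * (D * rho)).
    { assert (Ht := geo_tail _ _ _ _ _ HW h 1%nat Hh ltac:(fold rho; lra)).
      unfold Rball in Ht; cbn [rsum pow] in Ht; rewrite H0 in Ht; fold rho in Ht.
      replace (w h - (0 + 0)) with (w h) in Ht by ring; lra. }
    rewrite <- binom_series by lra.
    assert (Ht1 := binom_series_tail (w h) N ltac:(lra)).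
    (* The inner sums are extended by vanishing terms to a common range, so that the two finite sums
       can be exchanged. *)
    rewrite (rsum_ext N (fun n => rsum (n + 1) _)
      (fun n => rsum N (fun m => binom_coef m * cauchy_pow W m n (fun _ => h) tt))).
    2:{ intros n Hn; symmetry; apply rsum_extend0; [lia|].
        intros m Hm; rewrite cauchy_pow_low by (auto; lia); ring. }
    rewrite rsum_exchange.
    replace (PSeries binom_coef (w h) - _) with
      ((PSeries binom_coef (w h) - rsum N (fun m => binom_coef m * w h ^ m)) +
       rsum N (fun m => binom_coef m * (w h ^ m - rsum N (fun n => cauchy_pow W m n (fun _ => h) tt)))).
    2:{ rewrite (rsum_ext N (fun m => binom_coef m * (w h ^ m - _))
          (fun m => binom_coef m * w h ^ m +
             (-1) * rsum N (fun n => binom_coef m * cauchy_pow W m n (fun _ => h) tt))).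
        - rewrite rsum_plus, rsum_scal; ring.
        - intros m Hm; rewrite rsum_scal; ring. }
    eapply Rle_trans; [apply Rabs_triang|].
    set (th := K * (D * rho)) in *.
    assert (Ht2 : Rabs (rsum N (fun m => binom_coef m *
        (w h ^ m - rsum N (fun n => cauchy_pow W m n (fun _ => h) tt)))) <= INR N * (4 * th) ^ N).
    { eapply Rle_trans; [apply Rabs_rsum_le|]; rewrite <- rsum_const.
      apply rsum_le; intros m Hm; rewrite Rabs_mult.
      assert (Hb := geo_tail _ _ _ _ _ (HP m) h N Hh HD2); unfold Rball in Hb; fold rho in Hb.
      assert (Hc := Rabs_binom_coef_le m); assert (Hk := HKm m N ltac:(lia)).
      set (y := w h ^ m - rsum N (fun n => cauchy_pow W m n (fun _ => h) tt)) in *.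
      apply Rle_trans with (Rabs y); [pose proof (Rabs_pos y); nra|].
      eapply Rle_trans; [exact Hb|].
      replace (4 * th) with ((2 * K) * (2 * D * rho)) by (unfold th; ring).
      rewrite (Rpow_mult_distr (2 * K)); apply Rmult_le_compat_r; auto; apply pow_le; lra. }
    assert (Hwp : Rabs (w h) ^ N <= th ^ N) by (apply pow_incr; split; [apply Rabs_pos | exact Hw]).
    replace (8 * K * D * rho) with (2 * (4 * th)) by (unfold th; ring).
    assert (Hth : th ^ N <= (2 * (4 * th)) ^ N) by (apply pow_incr; lra).
    rewrite (Rpow_mult_distr 2 (4 * th)) in *.
    assert (INR N * (4 * th) ^ N <= 2 ^ N * (4 * th) ^ N).
    { pose proof (INR_le_pow2 N); apply Rmult_le_compat_r; [apply pow_le; lra | lra]. }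
    lra.
Qed.

(** * Values on the circle and the normalisation *)

Lemma zpow_of_nat (z : C) (n : nat) : zpow z (Z.of_nat n) = (z ^ n)%C.
Proof.
  destruct n as [|n]; [reflexivity|].
  unfold zpow; cbn [Z.of_nat]; now rewrite SuccNat2Pos.id_succ.
Qed.

Lemma zpow_neg_nat (z : C) (n : nat) : zpow z (- Z.of_nat n - 1) = ((/ z) ^ S n)%C.
Proof.
  replace (- Z.of_nat n - 1)%Z with (Zneg (Pos.of_succ_nat n)) by lia.
  unfold zpow; now rewrite SuccNat2Pos.id_succ.
Qed.

Lemma Z_halves (k : Z) : exists n : nat, k = Z.of_nat n \/ k = (- Z.of_nat n - 1)%Z.
Proof.
  destruct (Z_lt_le_dec k 0); [exists (Z.to_nat (- k - 1)) | exists (Z.to_nat k)]; lia.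
Qed.

Lemma zpow_succ (z : C) (k : Z) : z <> 0 -> zpow z (k + 1) = (z * zpow z k)%C.
Proof.
  intros Hz; destruct (Z_halves k) as [n [-> | ->]].
  - replace (Z.of_nat n + 1)%Z with (Z.of_nat (S n)) by lia.
    rewrite !zpow_of_nat; apply Cpow_S.
  - rewrite zpow_neg_nat, Cpow_S; destruct n as [|n].
    + cbn; field; exact Hz.
    + replace (- Z.of_nat (S n) - 1 + 1)%Z with (- Z.of_nat n - 1)%Z by lia.
      rewrite zpow_neg_nat; field; exact Hz.
Qed.

Lemma zpow_pred (z : C) (k : Z) : z <> 0 -> zpow z (k - 1) = (/ z * zpow z k)%C.
Proof.
  intros Hz; replace k with (k - 1 + 1)%Z at 2 by ring.
  rewrite zpow_succ by auto; field; exact Hz.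
Qed.

Lemma Cmod_1_nz (z : C) : Cmod z = 1 -> z <> 0.
Proof. intros H E; rewrite E, Cmod_0 in H; lra. Qed.

Lemma Cinv_unit (z : C) : Cmod z = 1 -> (/ z = Cconj z)%C.
Proof.
  intros H; pose proof (Cmod_1_nz z H) as Hz; pose proof (Cmod2_conj z) as E.
  rewrite H, pow1 in E; replace (/ z)%C with (/ z * RtoC 1)%C by ring.
  rewrite E; field; exact Hz.
Qed.

Lemma zpow_conj (z : C) (k : Z) : Cmod z = 1 -> Cconj (zpow z k) = zpow z (- k).
Proof.
  intros H; pose proof (Cmod_1_nz z H) as Hz.
  assert (Hn : forall n : nat, Cconj (zpow z (Z.of_nat n)) = zpow z (- Z.of_nat n)).
  { intros [|n]; [apply Cconj_RtoC|].
    replace (- Z.of_nat (S n))%Z with (- Z.of_nat n - 1)%Z by lia.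
    rewrite zpow_of_nat, zpow_neg_nat, Cinv_unit, Cpow_conj by auto; reflexivity. }
  destruct (Z_halves k) as [n [-> | ->]]; [apply Hn|].
  replace (- Z.of_nat n - 1)%Z with (- Z.of_nat (S n))%Z by lia.
  rewrite <- Hn, Cconj_conj; f_equal; lia.
Qed.

Lemma zpow_inv (z : C) (k : Z) : Cmod z = 1 -> (zpow z k * zpow z (- k) = 1)%C.
Proof.
  intros H; pose proof (Cmod_1_nz z H) as Hz.
  assert (Hn : forall n : nat, (zpow z (Z.of_nat n) * zpow z (- Z.of_nat n) = 1)%C).
  { intros [|n]; [cbn; ring|].
    replace (- Z.of_nat (S n))%Z with (- Z.of_nat n - 1)%Z by lia.
    rewrite zpow_of_nat, zpow_neg_nat, Cpow_inv by auto; field; now apply Cpow_nz. }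
  destruct (Z_halves k) as [n [-> | ->]]; [apply Hn|].
  replace (- Z.of_nat n - 1)%Z with (- Z.of_nat (S n))%Z by lia.
  rewrite Z.opp_involutive, Cmult_comm; apply Hn.
Qed.

Lemma is_series_Cmult (c : C) (f : nat -> C) (l : C) :
  is_series f l -> is_series (fun n => c * f n)%C (c * l)%C.
Proof. intros H; exact (is_series_scal (K := C_AbsRing) (V := C_NormedModule) c f l H). Qed.

Lemma is_series_Cconj (f : nat -> C) (l : C) :
  is_series f l -> is_series (fun n => Cconj (f n)) (Cconj l).
Proof.
  intros H; unfold is_series in *.
  apply filterlim_ext with (fun n => Cconj (sum_n f n)).
  - intros n; induction n as [|n IH]; [now rewrite !sum_O|].
    rewrite !sum_Sn, <- IH; apply Cplus_conj.
  - apply filterlim_locally; intros eps.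
    assert (He := proj1 (filterlim_locally (sum_n f) l) H eps).
    revert He; apply filter_imp; intros n [H1 H2]; split; [exact H1|].
    unfold ball in *; cbn in *; unfold AbsRing_ball, abs, minus, plus, opp in *; cbn in *.
    rewrite <- Rabs_Ropp; eapply Rle_lt_trans; [|exact H2]; right; f_equal; ring.
Qed.

Lemma is_series_Re (f : nat -> C) (l : C) :
  is_series f l -> is_series (fun n => Re (f n)) (Re l).
Proof.
  intros H; unfold is_series in *.
  apply filterlim_ext with (fun n => Re (sum_n f n)).
  - intros n; induction n as [|n IH]; [now rewrite !sum_O|].
    rewrite !sum_Sn, <- IH; reflexivity.
  - apply filterlim_locally; intros eps.
    assert (He := proj1 (filterlim_locally (sum_n f) l) H eps).
    revert He; apply filter_imp; intros n [H1 H2]; exact H1.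
Qed.

Lemma is_series_Im (f : nat -> C) (l : C) :
  is_series f l -> is_series (fun n => Im (f n)) (Im l).
Proof.
  intros H; unfold is_series in *.
  apply filterlim_ext with (fun n => Im (sum_n f n)).
  - intros n; induction n as [|n IH]; [now rewrite !sum_O|].
    rewrite !sum_Sn, <- IH; reflexivity.
  - apply filterlim_locally; intros eps.
    assert (He := proj1 (filterlim_locally (sum_n f) l) H eps).
    revert He; apply filter_imp; intros n [H1 H2]; exact H2.
Qed.

Ltac Cring := match goal with |- @eq _ ?a ?b => change (@eq C a b); ring end.
Ltac Cfield := match goal with |- @eq _ ?a ?b => change (@eq C a b); field end.

Lemma Zseries_ext (c d : seqZ) (z v w : C) :
  (forall k, c k = d k) -> v = w -> Zseries_to c z v -> Zseries_to d z w.
Proof.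
  intros Hcd <- H; replace d with c; auto; now apply functional_extensionality.
Qed.

Lemma Zseries_plus (c d : seqZ) (z v w : C) :
  Zseries_to c z v -> Zseries_to d z w -> Zseries_to (sadd c d) z (v + w).
Proof.
  intros (v1 & v2 & H1 & H2 & ->) (w1 & w2 & H3 & H4 & ->).
  exists (v1 + w1)%C, (v2 + w2)%C; repeat split; [| | ring].
  - eapply is_series_ext; [|exact (is_series_plus _ _ _ _ H1 H3)].
    intros n; unfold sadd; change plus with Cplus; cbn beta; Cring.
  - eapply is_series_ext; [|exact (is_series_plus _ _ _ _ H2 H4)].
    intros n; unfold sadd; change plus with Cplus; cbn beta; Cring.
Qed.

Lemma Zseries_scal (u : C) (c : seqZ) (z v : C) :
  Zseries_to c z v -> Zseries_to (fun k => u * c k)%C z (u * v).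
Proof.
  intros (v1 & v2 & H1 & H2 & ->).
  exists (u * v1)%C, (u * v2)%C; repeat split; [| | ring].
  - eapply is_series_ext; [|exact (is_series_Cmult u _ _ H1)]; intros n; cbn beta; Cring.
  - eapply is_series_ext; [|exact (is_series_Cmult u _ _ H2)]; intros n; cbn beta; Cring.
Qed.

Lemma is_series_Ctail (f : nat -> C) (l : C) :
  is_series f l -> is_series (fun n => f (S n)) (l - f O)%C.
Proof.
  intros H; apply (is_series_incr_1 (K := C_AbsRing) (V := C_NormedModule) f).
  change plus with Cplus; replace (l - f O + f O)%C with l by ring; exact H.
Qed.

Lemma is_series_Ccons (f : nat -> C) (l : C) :
  is_series (fun n => f (S n)) l -> is_series f (f O + l)%C.
Proof.
  intros H; apply (is_series_decr_1 (K := C_AbsRing) (V := C_NormedModule) f).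
  change plus with Cplus; change opp with Copp.
  replace (f O + l + - f O)%C with l by ring; exact H.
Qed.

(** The shift moves the coefficient at [-1] across the cut between the two half-series, and both
    half-sums are corrected by this one term. *)
Lemma Zseries_shift_1 (c : seqZ) (z v : C) :
  z <> 0 -> Zseries_to c z v -> Zseries_to (fun k => c (k - 1)%Z) z (z * v).
Proof.
  intros Hz (v1 & v2 & H1 & H2 & ->).
  exists (c (-1)%Z + z * v1)%C, (z * (v2 - c (-1)%Z * zpow z (-1)))%C; repeat split.
  - replace (c (-1)%Z + z * v1)%C with (c (Z.of_nat 0 - 1)%Z * zpow z (Z.of_nat 0) + z * v1)%C
      by (cbn; ring).
    apply (is_series_Ccons (fun n => c (Z.of_nat n - 1)%Z * zpow z (Z.of_nat n))%C).
    eapply is_series_ext; [|exact (is_series_Cmult z _ _ H1)].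
    intros n; cbn beta; replace (Z.of_nat (S n)) with (Z.of_nat n + 1)%Z by lia.
    rewrite zpow_succ by auto; replace (Z.of_nat n + 1 - 1)%Z with (Z.of_nat n) by ring.
    Cring.
  - apply is_series_Ctail in H2; eapply is_series_ext; [|exact (is_series_Cmult z _ _ H2)].
    intros n; cbn beta; replace (- Z.of_nat (S n) - 1)%Z with (- Z.of_nat n - 1 - 1)%Z by lia.
    rewrite (zpow_pred z (- Z.of_nat n - 1)) by auto; Cfield; exact Hz.
  - change (zpow z (-1)) with (/ z * 1)%C; field; exact Hz.
Qed.

Lemma Zseries_shift_m1 (c : seqZ) (z v : C) :
  z <> 0 -> Zseries_to c z v -> Zseries_to (fun k => c (k + 1)%Z) z (/ z * v).
Proof.
  intros Hz (v1 & v2 & H1 & H2 & ->).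
  exists (/ z * (v1 - c 0%Z * zpow z 0))%C, (c 0%Z * / z + / z * v2)%C; repeat split.
  - apply is_series_Ctail in H1; eapply is_series_ext; [|exact (is_series_Cmult (/ z) _ _ H1)].
    intros n; cbn beta; replace (Z.of_nat (S n)) with (Z.of_nat n + 1)%Z by lia.
    rewrite zpow_succ by auto; Cfield; exact Hz.
  - replace (c 0%Z * / z + / z * v2)%C with
      (c (- Z.of_nat 0 - 1 + 1)%Z * zpow z (- Z.of_nat 0 - 1) + / z * v2)%C
      by (change (zpow z (- Z.of_nat 0 - 1)) with (/ z * 1)%C; change (- Z.of_nat 0 - 1 + 1)%Z with 0%Z; ring).
    apply (is_series_Ccons (fun n => c (- Z.of_nat n - 1 + 1)%Z * zpow z (- Z.of_nat n - 1))%C).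
    eapply is_series_ext; [|exact (is_series_Cmult (/ z) _ _ H2)].
    intros n; cbn beta; replace (- Z.of_nat (S n) - 1)%Z with (- Z.of_nat n - 1 - 1)%Z by lia.
    rewrite (zpow_pred z (- Z.of_nat n - 1)) by auto.
    replace (- Z.of_nat n - 1 - 1 + 1)%Z with (- Z.of_nat n - 1)%Z by ring; Cring.
  - cbn [zpow]; field; exact Hz.
Qed.

Lemma Zseries_shift (c : seqZ) (z v : C) (k : Z) :
  z <> 0 -> Zseries_to c z v -> Zseries_to (fun n => c (n - k)%Z) z (zpow z k * v).
Proof.
  intros Hz H; destruct (Z_halves k) as [n Hn]; revert k Hn.
  induction n as [|n IH]; intros k [-> | ->].
  - apply Zseries_ext with c v; auto; [intros; f_equal; lia | cbn [zpow Z.of_nat]; ring].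
  - eapply Zseries_ext; [| |exact (Zseries_shift_m1 c z v Hz H)].
    + intros; cbn beta; f_equal; lia.
    + change (zpow z (- Z.of_nat 0 - 1)) with (/ z * 1)%C; ring.
  - eapply Zseries_ext; [| |apply (Zseries_shift_1 _ z _ Hz (IH _ (or_introl eq_refl)))].
    + intros; cbn beta; f_equal; lia.
    + replace (Z.of_nat (S n)) with (Z.of_nat n + 1)%Z by lia; rewrite zpow_succ by auto; Cring.
  - eapply Zseries_ext; [| |apply (Zseries_shift_m1 _ z _ Hz (IH _ (or_intror eq_refl)))].
    + intros; cbn beta; f_equal; lia.
    + replace (- Z.of_nat (S n) - 1)%Z with (- Z.of_nat n - 1 - 1)%Z by lia.
      rewrite (zpow_pred z (- Z.of_nat n - 1)) by auto; Cring.
Qed.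

(** The reflection [n -> - n - 1] exchanges the two half-series exactly, with no term crossing the
    cut; a shift by one then gives [n -> - n]. *)
Lemma Zseries_star (c : seqZ) (z v : C) :
  Cmod z = 1 -> Zseries_to c z v -> Zseries_to (fun n => Cconj (c (- n)%Z)) z (Cconj v).
Proof.
  intros H1 H; pose proof (Cmod_1_nz z H1) as Hz.
  assert (Hr : Zseries_to (fun n => Cconj (c (- n - 1)%Z)) z (/ z * Cconj v)).
  { destruct H as (v1 & v2 & Hv1 & Hv2 & ->).
    exists (/ z * Cconj v2)%C, (/ z * Cconj v1)%C; repeat split.
    - eapply is_series_ext; [|exact (is_series_Cmult (/ z) _ _ (is_series_Cconj _ _ Hv2))].
      intros n; cbn beta; rewrite Cmult_conj, zpow_conj by auto.
      replace (- (- Z.of_nat n - 1))%Z with (Z.of_nat n + 1)%Z by ring.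
      rewrite zpow_succ by auto; Cfield; exact Hz.
    - eapply is_series_ext; [|exact (is_series_Cmult (/ z) _ _ (is_series_Cconj _ _ Hv1))].
      intros n; cbn beta; rewrite Cmult_conj, zpow_conj by auto.
      rewrite zpow_pred by auto.
      replace (- (- Z.of_nat n - 1) - 1)%Z with (Z.of_nat n) by ring; Cring.
    - rewrite Cplus_conj; ring. }
  eapply Zseries_ext; [| |exact (Zseries_shift_1 _ z _ Hz Hr)].
  - intros k; cbn beta; do 2 f_equal; lia.
  - field; exact Hz.
Qed.

Definition evaluates (s : pseq) (z a b : C) : Prop :=
  Zseries_to (fst s) z a /\ Zseries_to (snd s) z b.

Lemma evaluates_padd (s t : pseq) (z a b a' b' : C) :
  evaluates s z a b -> evaluates t z a' b' -> evaluates (padd s t) z (a + a') (b + b').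
Proof. intros [H1 H2] [H3 H4]; split; now apply Zseries_plus. Qed.

Lemma evaluates_step_even (m : nat) (u : C) (s : pseq) (z a b : C) :
  Cmod z = 1 -> Nat.even m = true -> evaluates s z a b ->
  evaluates (step m u s) z (- Cconj u * (zpow z (- site m) * b)) (u * (zpow z (site m) * a)).
Proof.
  intros H1 Hm [Ha Hb]; pose proof (Cmod_1_nz z H1) as Hz; unfold step; rewrite Hm.
  split; cbn [fst snd]; apply Zseries_scal.
  - eapply Zseries_ext; [|reflexivity|exact (Zseries_shift _ z _ (- site m) Hz Hb)].
    intros k; cbn beta; f_equal; ring.
  - exact (Zseries_shift _ z _ (site m) Hz Ha).
Qed.

Lemma evaluates_step_odd (m : nat) (u : C) (s : pseq) (z a b : C) :
  Cmod z = 1 -> Nat.even m = false -> evaluates s z a b ->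
  evaluates (step m u s) z (- u * (zpow z (site m) * Cconj b)) (u * (zpow z (site m) * Cconj a)).
Proof.
  intros H1 Hm [Ha Hb]; pose proof (Cmod_1_nz z H1) as Hz; unfold step; rewrite Hm.
  split; cbn [fst snd]; apply Zseries_scal.
  - eapply Zseries_ext; [|reflexivity|exact (Zseries_shift _ z _ (site m) Hz (Zseries_star _ z _ H1 Hb))].
    intros k; cbn beta; do 2 f_equal; ring.
  - eapply Zseries_ext; [|reflexivity|exact (Zseries_shift _ z _ (site m) Hz (Zseries_star _ z _ H1 Ha))].
    intros k; cbn beta; do 2 f_equal; ring.
Qed.

Lemma is_series_C0 : is_series (fun _ : nat => RtoC 0) (RtoC 0).
Proof.
  unfold is_series; apply filterlim_ext with (fun _ : nat => RtoC 0); [|apply filterlim_const].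
  intros n; induction n as [|n IH]; [now rewrite sum_O|].
  rewrite sum_Sn, <- IH; change plus with Cplus; ring.
Qed.

Lemma evaluates_pone (z : C) : evaluates pone z 1 0.
Proof.
  assert (E0 : forall f : nat -> C, (forall n, f n = RtoC 0) -> is_series f (RtoC 0)).
  { intros f Hf; apply is_series_ext with (fun _ => RtoC 0); auto; apply is_series_C0. }
  split; unfold pone; cbn [fst snd].
  - exists (RtoC 1), (RtoC 0); repeat split; [| |ring].
    + set (f := fun n : nat => ((if Z.eqb (Z.of_nat n) 0 then RtoC 1 else RtoC 0) * zpow z (Z.of_nat n))%C).
      assert (H : is_series f (f O + 0)%C).
      { apply is_series_Ccons, E0; intros n; unfold f.
        destruct (Z.eqb_spec (Z.of_nat (S n)) 0); [lia | ring]. }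
      replace (f O + 0)%C with (RtoC 1) in H; [exact H|].
      change (RtoC 1 = RtoC 1 * RtoC 1 + 0)%C; ring.
    + apply E0; intros n; destruct (Z.eqb_spec (- Z.of_nat n - 1) 0); [lia | ring].
  - exists (RtoC 0), (RtoC 0); repeat split; [| |ring]; apply E0; intros n; ring.
Qed.

Lemma mmul_assoc (A B D : mat2) : mmul A (mmul B D) = mmul (mmul A B) D.
Proof. unfold mmul; cbn; f_equal; ring. Qed.

Lemma nlft_prod_snoc (F : seqZ) (z : C) (k : Z) (l : nat) :
  nlft_prod F z k (S l) = mmul (nlft_prod F z k l) (nlft_factor F z (k + Z.of_nat l)).
Proof.
  revert k; induction l as [|l IH]; intros k.
  - cbn -[nlft_factor]; replace (k + 0)%Z with k by ring.
    destruct (nlft_factor F z k); unfold mmul, mid; cbn; f_equal; ring.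
  - change (nlft_prod F z k (S (S l))) with
      (mmul (nlft_factor F z k) (nlft_prod F z (k + 1) (S l))).
    rewrite IH, mmul_assoc; f_equal; f_equal; lia.
Qed.

Fixpoint normalizer (F : seqZ) (m : nat) : R :=
  match m with
  | O => 1
  | S m' => normalizer F m' * / sqrt (1 + Cmod (F (site m')) ^ 2)
  end.

(** On the circle every partial product is a real multiple of a matrix with rows [(a, b)] and
    [(- conj b, conj a)], so the first row carries all the information and multiplication from the
    left can be expressed by it. After [m] steps the product covers [m] consecutive sites beginning
    at [- div2 m]: an even [m] adds the next site on the right, an odd [m] the next one on the left.
    The last clause is the determinant. *)
Lemma nlf_evaluates (F : seqZ) (z : C) (m : nat) :
  Cmod z = 1 ->
  exists a b : C,
    evaluates (nlf F m) z a b /\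
    nlft_prod F z (- Z.of_nat (Nat.div2 m)) m =
      (let p := RtoC (normalizer F m) in Mat2 (p * a) (p * b) (- (p * Cconj b)) (p * Cconj a))%C /\
    normalizer F m ^ 2 * (Cmod a ^ 2 + Cmod b ^ 2) = 1.
Proof.
  intros Hz; induction m as [|m (a & b & He & Hp & Hn)].
  - exists (RtoC 1), (RtoC 0); split; [apply evaluates_pone|]; split.
    + cbn; unfold mid; f_equal; rewrite ?Cconj_RtoC; ring.
    + cbn; rewrite Cmod_0, Cmod_1; ring.
  - set (u := F (site m)); set (w := zpow z (site m)); set (w' := zpow z (- site m)).
    assert (Hw : Cconj w = w') by now apply zpow_conj.
    assert (Hw' : Cconj w' = w) by (rewrite <- Hw; apply Cconj_conj).
    assert (Hww : (w * w')%C = RtoC 1) by now apply zpow_inv.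
    set (s := / sqrt (1 + Cmod u ^ 2)).
    assert (Hs : s ^ 2 * (1 + Cmod u ^ 2) = 1).
    { unfold s; rewrite pow_inv, pow2_sqrt; [field|]; pose proof (pow2_ge_0 (Cmod u)); lra. }
    assert (Hnorm : forall a' b' : C, Cmod a' ^ 2 + Cmod b' ^ 2 = (1 + Cmod u ^ 2) * (Cmod a ^ 2 + Cmod b ^ 2) ->
      normalizer F (S m) ^ 2 * (Cmod a' ^ 2 + Cmod b' ^ 2) = 1).
    { intros a' b' ->; cbn [normalizer]; fold u; fold s.
      replace ((normalizer F m * s) ^ 2 * ((1 + Cmod u ^ 2) * (Cmod a ^ 2 + Cmod b ^ 2))) with
        ((s ^ 2 * (1 + Cmod u ^ 2)) * (normalizer F m ^ 2 * (Cmod a ^ 2 + Cmod b ^ 2))) by ring.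
      rewrite Hs, Hn; ring. }
    assert (Hfac : nlft_factor F z (site m) =
      Mat2 s (RtoC s * (u * w)) (RtoC s * - (Cconj u * w')) s) by reflexivity.
    assert (Hpm : RtoC (normalizer F (S m)) = (RtoC (normalizer F m) * RtoC s)%C)
      by apply RtoC_mult.
    destruct (nat_parity m) as [n [E|E]].
    + assert (Hev : Nat.even m = true) by (rewrite E; apply Nat.even_even).
      exists (a + - Cconj u * (w' * b))%C, (b + u * (w * a))%C; split; [|split].
      * rewrite nlf_S; apply evaluates_padd; [exact He|].
        now apply evaluates_step_even.
      * rewrite nlft_prod_snoc.
        replace (- Z.of_nat (Nat.div2 (S m)))%Z with (- Z.of_nat (Nat.div2 m))%Z
          by (rewrite E, Nat.div2_succ_double, Nat.div2_double; reflexivity).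
        rewrite Hp.
        replace (- Z.of_nat (Nat.div2 m) + Z.of_nat m)%Z with (site m)
          by (rewrite E at 1 3; rewrite site_double; rewrite E at 1; rewrite Nat.div2_double; lia).
        rewrite Hfac, Hpm; unfold mmul; cbn [m11 m12 m21 m22].
        rewrite !Cplus_conj, !Cmult_conj, Copp_conj, Cconj_conj, Hw, Hw'; f_equal; ring.
      * apply Hnorm, RtoC_inj; rewrite !RtoC_plus, !RtoC_mult, !RtoC_plus, !Cmod2_conj.
        rewrite !Cplus_conj, !Cmult_conj, Copp_conj, Cconj_conj, Hw, Hw'.
        replace (RtoC 1) with (w * w')%C by exact Hww.
        transitivity ((a * Cconj a + b * Cconj b) * 1 + (u * Cconj u) * (a * Cconj a + b * Cconj b) * (w * w'))%C;
          [ring|]; rewrite !Hww; ring.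
    + assert (Hev : Nat.even m = false).
      { rewrite E, Nat.even_succ, <- Nat.negb_even, Nat.even_even; reflexivity. }
      exists (a + - u * (w * Cconj b))%C, (b + u * (w * Cconj a))%C; split; [|split].
      * rewrite nlf_S; apply evaluates_padd; [exact He|].
        now apply evaluates_step_odd.
      * assert (Hsite : site m = (- Z.of_nat n - 1)%Z) by (rewrite E; apply site_double_S).
        replace (- Z.of_nat (Nat.div2 (S m)))%Z with (site m)
          by (rewrite Hsite, E; change (S (S (2 * n))) with (2 + 2 * n)%nat;
              replace (2 + 2 * n)%nat with (2 * (n + 1))%nat by lia;
              rewrite Nat.div2_double; lia).
        change (nlft_prod F z (site m) (S m)) with
          (mmul (nlft_factor F z (site m)) (nlft_prod F z (site m + 1) m)).
        replace (site m + 1)%Z with (- Z.of_nat (Nat.div2 m))%Z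
          by (rewrite Hsite, E, Nat.div2_succ_double; lia).
        rewrite Hp, Hfac, Hpm; unfold mmul; cbn [m11 m12 m21 m22].
        rewrite !Cplus_conj, !Cmult_conj, Copp_conj, !Cconj_conj, Hw; f_equal; ring.
      * apply Hnorm, RtoC_inj; rewrite !RtoC_plus, !RtoC_mult, !RtoC_plus, !Cmod2_conj.
        rewrite !Cplus_conj, !Cmult_conj, Copp_conj, !Cconj_conj, Hw.
        transitivity ((a * Cconj a + b * Cconj b) * 1 + (u * Cconj u) * (a * Cconj a + b * Cconj b) * (w * w'))%C;
          [ring|]; rewrite !Hww; ring.
Qed.

(** * Bounded functionals at [z = 1] and the limit of the normalisation *)

Definition part (r : bool) (c : C) : R := if r then Re c else Im c.
Definition entry (e : bool) (p : pseq) : seqZ := if e then fst p else snd p.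

(* The real ([r]) and imaginary parts of the values of [a] ([e]) and [b] at [z = 1]. *)
Definition value1 (e r : bool) (p : pseq) : R :=
  Series (fun n => part r (entry e p (Z.of_nat n)) + part r (entry e p (- Z.of_nat n - 1)%Z)).

Lemma Rabs_part_le (r : bool) (c : C) : Rabs (part r c) <= Cmod c.
Proof. destruct r; [apply re_le_Cmod | apply Rabs_Im_le_Cmod]. Qed.

Lemma l1le_entry (e : bool) (p : pseq) (K : R) : ple p K -> l1le (entry e p) K.
Proof. destruct e; [apply ple_fst | apply ple_snd]. Qed.

Lemma value1_terms_le (e r : bool) (p : pseq) (n : nat) :
  Rabs (part r (entry e p (Z.of_nat n)) + part r (entry e p (- Z.of_nat n - 1)%Z)) <=
  Cmod (entry e p (Z.of_nat n)) + Cmod (entry e p (- Z.of_nat n - 1)%Z).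
Proof.
  eapply Rle_trans; [apply Rabs_triang | apply Rplus_le_compat; apply Rabs_part_le].
Qed.

Lemma ex_series_value1 (e r : bool) (p : pseq) :
  pl1 p -> ex_series (fun n => Rabs (part r (entry e p (Z.of_nat n)) +
                                     part r (entry e p (- Z.of_nat n - 1)%Z))).
Proof.
  intros H; destruct (l1le_entry e p _ (ple_norm p H)) as [He _].
  eapply (ex_series_le (K := R_AbsRing) (V := R_CompleteNormedModule)); [|exact He].
  intros n; change norm with Rabs; rewrite Rabs_Rabsolu; apply value1_terms_le.
Qed.

Lemma Rabs_value1_le (e r : bool) (p : pseq) (K : R) : ple p K -> Rabs (value1 e r p) <= K.
Proof.
  intros H; destruct (l1le_entry e p K H) as [He HK].
  eapply Rle_trans; [apply Series_Rabs, ex_series_value1, H|].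
  eapply Rle_trans; [|exact HK]; apply Series_le; auto.
  intros n; split; [apply Rabs_pos | apply value1_terms_le].
Qed.

Lemma part_plus (r : bool) (c d : C) : part r (c + d) = part r c + part r d.
Proof. destruct r; reflexivity. Qed.

Lemma part_scal (r : bool) (a : R) (c : C) : part r (a * c) = a * part r c.
Proof. destruct r; unfold part, Re, Im; cbn; ring. Qed.

Lemma entry_padd (e : bool) (p q : pseq) (k : Z) :
  entry e (padd p q) k = (entry e p k + entry e q k)%C.
Proof. destruct e; reflexivity. Qed.

Lemma entry_pscal (e : bool) (a : R) (p : pseq) (k : Z) :
  entry e (pscal a p) k = (a * entry e p k)%C.
Proof. destruct e; reflexivity. Qed.

Lemma value1_padd (e r : bool) (p q : pseq) :
  pl1 p -> pl1 q -> value1 e r (padd p q) = value1 e r p + value1 e r q.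
Proof.
  intros Hp Hq; unfold value1; rewrite <- Series_plus;
    [|now apply ex_series_Rabs, ex_series_value1..].
  apply Series_ext; intros n; rewrite !entry_padd, !part_plus; ring.
Qed.

Lemma value1_pscal (e r : bool) (a : R) (p : pseq) : value1 e r (pscal a p) = a * value1 e r p.
Proof.
  unfold value1; rewrite <- Series_scal_l.
  apply Series_ext; intros n; rewrite !entry_pscal, !part_scal; ring.
Qed.

Lemma psub_padd (p q : pseq) : psub p q = padd p (pscal (-1) q).
Proof. pseq_ring. Qed.

Lemma pl1_pscal (a : R) (p : pseq) : pl1 p -> pl1 (pscal a p).
Proof. intros H; exact (proj1 (ple_pscal a p _ (ple_norm p H))). Qed.

Lemma value1_psub (e r : bool) (p q : pseq) :
  pl1 p -> pl1 q -> value1 e r (psub p q) = value1 e r p - value1 e r q.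
Proof.
  intros Hp Hq; rewrite psub_padd, value1_padd, value1_pscal by auto using pl1_pscal; ring.
Qed.

Lemma value1_evaluates (e r : bool) (p : pseq) (a b : C) :
  evaluates p 1 a b -> value1 e r p = part r (if e then a else b).
Proof.
  intros [Ha Hb].
  assert (H : Zseries_to (entry e p) 1 (if e then a else b)) by now destruct e.
  destruct H as (v1 & v2 & H1 & H2 & ->); unfold value1; rewrite part_plus.
  apply is_series_unique.
  assert (E : forall k, zpow 1 k = RtoC 1).
  { intros k; destruct (Z_halves k) as [n [-> | ->]].
    - rewrite zpow_of_nat; apply Cpow_1_l.
    - rewrite zpow_neg_nat; replace (/ RtoC 1)%C with (RtoC 1) by field; apply Cpow_1_l. }
  assert (P : forall (f : nat -> C) (l : C), is_series f l -> is_series (fun n => part r (f n)) (part r l))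
    by (intros f l Hf; destruct r; [now apply is_series_Re | now apply is_series_Im]).
  apply (is_series_plus (K := R_AbsRing) (V := R_NormedModule)).
  - eapply is_series_ext; [|exact (P _ _ H1)]; intros n; cbn beta; now rewrite E, Cmult_1_r.
  - eapply is_series_ext; [|exact (P _ _ H2)]; intros n; cbn beta; now rewrite E, Cmult_1_r.
Qed.

Definition value1_sqr (p : pseq) : R :=
  value1 true true p ^ 2 + value1 true false p ^ 2 + value1 false true p ^ 2 + value1 false false p ^ 2.

Lemma nlf_value1_sqr (F : seqZ) (m : nat) : normalizer F m ^ 2 * value1_sqr (nlf F m) = 1.
Proof.
  destruct (nlf_evaluates F 1 m Cmod_1) as (a & b & He & _ & Hn).
  rewrite <- Hn; f_equal; unfold value1_sqr; rewrite !(value1_evaluates _ _ _ a b He).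
  rewrite !Cmod2_alt; unfold part; ring.
Qed.

Lemma value1_lim (e r : bool) (u : nat -> pseq) (l : pseq) :
  (forall m, pl1 (u m)) -> pl1 l -> pconv u l ->
  is_lim_seq (fun m => value1 e r (u m)) (value1 e r l).
Proof.
  intros Hu Hl (tau & Ht & H).
  assert (H0 : is_lim_seq (fun m => value1 e r (u m) - value1 e r l) 0).
  { apply is_lim_seq_abs_0; apply is_lim_seq_le_le with (fun _ => 0) tau; auto.
    - intros m; split; [apply Rabs_pos|]; rewrite Rabs_minus_sym, <- value1_psub by auto.
      now apply Rabs_value1_le.
    - apply is_lim_seq_const. }
  apply is_lim_seq_ext with (fun m => (value1 e r (u m) - value1 e r l) + value1 e r l);
    [intros; ring|].
  replace (Finite (value1 e r l)) with (Finite (0 + value1 e r l)) by (f_equal; ring).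
  apply is_lim_seq_plus'; auto; apply is_lim_seq_const.
Qed.

Lemma nlf_pl1 (F : seqZ) (m : nat) : pl1 (nlf F m).
Proof. exact (proj1 (jet_ple F m 0 (fun _ => F))). Qed.

Lemma nlf_lim_pl1 (F : seqZ) : l1 F -> pl1 (nlf_lim F).
Proof. intros H; exact (proj1 (jet_lim_ple F 0 (fun _ => F) H (fun _ => H))). Qed.

Lemma normalizer_bounds (F : seqZ) (m : nat) : 0 < normalizer F m <= 1.
Proof.
  induction m as [|m IH]; cbn [normalizer]; [lra|].
  set (u := F (site m)); assert (H : 1 <= sqrt (1 + Cmod u ^ 2)).
  { rewrite <- sqrt_1 at 1; apply sqrt_le_1_alt; pose proof (pow2_ge_0 (Cmod u)); lra. }
  assert (0 < / sqrt (1 + Cmod u ^ 2)) by (apply Rinv_0_lt_compat; lra).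
  assert (/ sqrt (1 + Cmod u ^ 2) <= 1) by (rewrite <- Rinv_1 at 2; apply Rinv_le_contravar; lra).
  split; [apply Rmult_lt_0_compat; lra | nra].
Qed.

(** This bound survives the limit and keeps the inverse square root away from its singularity. *)
Lemma value1_sqr_nlf_ge1 (F : seqZ) (m : nat) : 1 <= value1_sqr (nlf F m).
Proof.
  pose proof (nlf_value1_sqr F m) as H; pose proof (normalizer_bounds F m) as Hb.
  assert (Hq : 0 <= value1_sqr (nlf F m)) by (unfold value1_sqr; nra).
  assert (normalizer F m ^ 2 <= 1) by nra; nra.
Qed.

Lemma value1_sqr_lim (F : seqZ) :
  l1 F -> is_lim_seq (fun m => value1_sqr (nlf F m)) (value1_sqr (nlf_lim F)).
Proof.
  intros HF.
  assert (Hv : forall e r, is_lim_seq (fun m => value1 e r (nlf F m) ^ 2) (value1 e r (nlf_lim F) ^ 2)).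
  { intros e r; pose proof (value1_lim e r _ _ (nlf_pl1 F) (nlf_lim_pl1 F HF) (nlf_conv F HF)) as H.
    apply is_lim_seq_ext with (fun m => value1 e r (nlf F m) * value1 e r (nlf F m)); [intros; ring|].
    replace (value1 e r (nlf_lim F) ^ 2) with (value1 e r (nlf_lim F) * value1 e r (nlf_lim F)) by ring.
    now apply is_lim_seq_mult'. }
  unfold value1_sqr; repeat apply is_lim_seq_plus'; apply Hv.
Qed.

Lemma value1_sqr_ge1 (F : seqZ) : l1 F -> 1 <= value1_sqr (nlf_lim F).
Proof.
  intros HF; apply (is_lim_seq_le (fun _ => 1) (fun m => value1_sqr (nlf F m)) 1 (value1_sqr (nlf_lim F))).
  - apply value1_sqr_nlf_ge1.
  - apply is_lim_seq_const.
  - now apply value1_sqr_lim.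
Qed.

(* Evaluating determinants at [z = 1] gives [|a(1)|^2 + |b(1)|^2 = prod_k (1 + |F k|^2)], which
   expresses the normalisation through the unnormalised series. *)
Definition scale (F : seqZ) : R := / sqrt (value1_sqr (nlf_lim F)).

Lemma normalizer_eq (F : seqZ) (m : nat) : normalizer F m = / sqrt (value1_sqr (nlf F m)).
Proof.
  pose proof (nlf_value1_sqr F m) as H; pose proof (normalizer_bounds F m) as Hb.
  pose proof (value1_sqr_nlf_ge1 F m) as Hq; rewrite <- (sqrt_pow2 (normalizer F m)) by lra.
  rewrite <- sqrt_inv; f_equal; apply Rmult_eq_reg_r with (value1_sqr (nlf F m)); [|lra].
  rewrite H; field; lra.
Qed.

Lemma normalizer_lim (F : seqZ) : l1 F -> is_lim_seq (normalizer F) (scale F).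
Proof.
  intros HF; apply is_lim_seq_ext with (fun m => / sqrt (value1_sqr (nlf F m)));
    [intros; symmetry; apply normalizer_eq|].
  pose proof (value1_sqr_ge1 F HF) as H1.
  apply (is_lim_seq_continuous (fun x => / sqrt x)); [|now apply value1_sqr_lim].
  apply continuity_pt_inv; [apply continuity_pt_sqrt; lra|].
  pose proof (sqrt_lt_R0 (value1_sqr (nlf_lim F))); lra.
Qed.

Definition nlfs (F : seqZ) : pseq := pscal (scale F) (nlf_lim F).

Lemma nlfs_pl1 (F : seqZ) : l1 F -> pl1 (nlfs F).
Proof. intros H; now apply pl1_pscal, nlf_lim_pl1. Qed.

Lemma l1_finitely_supported (F : seqZ) (N : nat) : finitely_supported_in F N -> l1 F.
Proof.
  intros H; apply (l1le_of_lsum F (lsum F (window (N + 1)))); intros L HL.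
  apply Rle_trans with (lsum F (filter (fun k => Z.leb (Z.abs k) (Z.of_nat N)) L)).
  - clear HL; induction L as [|k L IH]; simpl; [lra|].
    destruct (Z.leb_spec (Z.abs k) (Z.of_nat N)); simpl; [lra|].
    rewrite (H k) by lia; rewrite Cmod_0; lra.
  - apply lsum_incl; [now apply NoDup_filter|].
    intros k Hk; apply filter_In in Hk; apply in_window.
    destruct Hk as [_ Hk]; apply Z.leb_le in Hk; lia.
Qed.

Lemma site_large (N m : nat) : (2 * N + 1 <= m)%nat -> (Z.abs (site m) > Z.of_nat N)%Z.
Proof.
  destruct (nat_parity m) as [n [-> | ->]]; rewrite ?site_double, ?site_double_S; lia.
Qed.

(** The first [2 * N + 1] sites are exactly the integers from [- N] to [N]; later steps have entry
    zero, so the unnormalised products are constant from there on and their limit is attained. *)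
Lemma nlfs_finitely_supported (F : seqZ) (N : nat) (z : C) :
  finitely_supported_in F N -> Cmod z = 1 ->
  Zseries_to (fst (nlfs F)) z (fst (nlfs_fin F N z)) /\
  Zseries_to (snd (nlfs F)) z (snd (nlfs_fin F N z)).
Proof.
  intros HF Hz; assert (HF1 := l1_finitely_supported F N HF).
  assert (E : nlf_lim F = nlf F (2 * N + 1)).
  { apply pconv_eventually; [now apply nlf_conv|]; intros m Hm.
    induction Hm as [|m Hm IH]; [reflexivity|].
    rewrite nlf_S, HF by (apply site_large; lia); rewrite step_0_l, padd_pzero_r; exact IH. }
  destruct (nlf_evaluates F z (2 * N + 1) Hz) as (a & b & [Ha Hb] & Hp & _).
  replace (Nat.div2 (2 * N + 1)) with N in Hp
    by (rewrite Nat.add_1_r, Nat.div2_succ_double; reflexivity).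
  unfold nlfs_fin; rewrite Hp; cbn [fst snd m11 m12].
  rewrite normalizer_eq, <- E; fold (scale F); unfold nlfs; rewrite E.
  split; now apply Zseries_scal.
Qed.

(** * Analyticity *)

(** An index selects the entry of the pair, the real or imaginary part, and the frequency; this
    presents pairs as real families for [geometric]. *)
Definition coords (p : pseq) (t : bool * bool * Z) : R :=
  let '(e, r, k) := t in part r (entry e p k).

Definition of_coords (x : bool * bool * Z -> R) : pseq :=
  (fun k => (x (true, true, k), x (true, false, k)), fun k => (x (false, true, k), x (false, false, k))).

Lemma C_ext (c d : C) : Re c = Re d -> Im c = Im d -> c = d.
Proof. destruct c, d; cbn; now intros -> ->. Qed.

Lemma of_coords_coords (p : pseq) : of_coords (coords p) = p.
Proof. now apply pseq_ext; intros k; apply C_ext. Qed.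

Lemma of_coords_plus (x y : bool * bool * Z -> R) :
  of_coords (fun t => x t + y t) = padd (of_coords x) (of_coords y).
Proof. now apply pseq_ext; intros k; apply C_ext. Qed.

Lemma of_coords_scal (c : R) (x : bool * bool * Z -> R) :
  of_coords (fun t => c * x t) = pscal c (of_coords x).
Proof. apply pseq_ext; intros k; apply C_ext; cbn; ring. Qed.

Lemma of_coords_zero : of_coords (fun _ => 0) = pzero.
Proof. reflexivity. Qed.

Lemma of_coords_tail (p : pseq) (N : nat) (x : nat -> bool * bool * Z -> R) :
  of_coords (fun t => coords p t - rsum N (fun n => x n t)) =
  psub p (psum N (fun n => of_coords (x n))).
Proof.
  assert (E : of_coords (fun t => rsum N (fun n => x n t)) = psum N (fun n => of_coords (x n))).
  { induction N as [|N IH]; [apply of_coords_zero|]; cbn [rsum psum].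
    rewrite <- IH; apply (of_coords_plus (fun t => rsum N (fun n => x n t))). }
  replace (fun t => coords p t - rsum N (fun n => x n t)) with
    (fun t => coords p t + (-1) * rsum N (fun n => x n t))
    by (apply functional_extensionality; intros t; ring).
  rewrite (of_coords_plus (coords p)), of_coords_scal, of_coords_coords, E; symmetry; apply psub_padd.
Qed.

Definition Pball (x : bool * bool * Z -> R) (K : R) : Prop := ple (of_coords x) K.

Lemma is_ball_Pball : is_ball Pball.
Proof.
  unfold Pball; constructor.
  - intros x y a b Ha Hb; rewrite of_coords_plus; now apply ple_padd.
  - intros c x a Ha; rewrite of_coords_scal; now apply ple_pscal.
  - intros x a b; apply ple_mono.
  - rewrite of_coords_zero; apply ple_zero.
Qed.

Lemma geometric_ext {X : Type} (B : (X -> R) -> R -> Prop) (f g : seqZ -> X -> R) A (K D : R) :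
  (forall h t, f h t = g h t) -> geometric B f A K D -> geometric B g A K D.
Proof.
  intros H; replace g with f; auto.
  apply functional_extensionality; intros h; apply functional_extensionality; auto.
Qed.

Lemma jet_lim_pl1 (x : seqZ) (n : nat) (v : nat -> seqZ) :
  l1 x -> (forall j, l1 (v j)) -> pl1 (jet_lim x n v).
Proof. intros Hx Hv; exact (proj1 (jet_lim_ple x n v Hx Hv)). Qed.

Lemma jet_lim_bound_1 (x : seqZ) (n : nat) (v : nat -> seqZ) :
  l1 x -> (forall j, l1 (v j)) ->
  ple (jet_lim x n v) (exp (l1_norm x + 1) * 1 ^ n * prod_norms n v).
Proof.
  intros Hx Hv; eapply ple_mono; [now apply jet_lim_ple|].
  rewrite pow1, Rmult_1_r; apply Rmult_le_compat_r; [|apply exp_mono; lra].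
  apply prod_norms_ge0; intros; now apply l1_norm_ge0.
Qed.

(** At rate 1 the increment satisfies [|h| <= 1], so [exp (|x| + |h|)] becomes a constant depending
    on the centre alone. *)
Lemma jet_lim_tail_1 (x h : seqZ) (N : nat) :
  l1 x -> l1 h -> 1 * l1_norm h <= 1 ->
  ple (psub (nlf_lim (sadd x h)) (psum N (fun n => jet_lim x n (fun _ => h))))
      (exp (l1_norm x + 1) * (1 * l1_norm h) ^ N).
Proof.
  intros Hx Hh H1; eapply ple_mono; [now apply jet_lim_tail|]; rewrite Rmult_1_l in *.
  apply Rmult_le_compat_r; [apply pow_le; now apply l1_norm_ge0 | apply exp_mono; lra].
Qed.

Lemma geometric_nlf (x : seqZ) :
  l1 x ->
  geometric Pball (fun h => coords (nlf_lim (sadd x h))) (fun n v => coords (jet_lim x n v))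
    (exp (l1_norm x + 1)) 1.
Proof.
  intros Hx; constructor; unfold Pball.
  - intros n; split.
    + intros v w Hvw; now rewrite (jet_lim_ext x n v w).
    + intros v i y z a b [[e r] k] Hi Hv Hy Hz; cbn [coords].
      rewrite jet_lim_linear, entry_padd, !entry_pscal, part_plus, !part_scal by auto; ring.
  - intros n v Hv; rewrite of_coords_coords; now apply jet_lim_bound_1.
  - intros h N Hh H1; rewrite (of_coords_tail _ N (fun n => coords (jet_lim x n (fun _ => h)))).
    replace (fun n => of_coords (coords (jet_lim x n (fun _ => h)))) with
      (fun n => jet_lim x n (fun _ => h))
      by (apply functional_extensionality; intros n; now rewrite of_coords_coords).
    now apply jet_lim_tail_1.
Qed.

Lemma value1_psum (e r : bool) (N : nat) (u : nat -> pseq) :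
  (forall n, pl1 (u n)) ->
  pl1 (psum N u) /\ value1 e r (psum N u) = rsum N (fun n => value1 e r (u n)).
Proof.
  intros Hu; induction N as [|N [IH1 IH2]]; cbn [psum rsum].
  - split; [exact (proj1 ple_zero)|].
    pose proof (Rabs_value1_le e r pzero 0 ple_zero) as H.
    destruct (Req_dec (value1 e r pzero) 0) as [E|E]; auto.
    apply Rabs_pos_lt in E; lra.
  - split; [exact (proj1 (ple_padd _ _ _ _ (ple_norm _ IH1) (ple_norm _ (Hu N))))|].
    now rewrite value1_padd, IH2 by auto.
Qed.

Lemma geometric_value1 (x : seqZ) (e r : bool) :
  l1 x ->
  geometric Rball (fun h _ => value1 e r (nlf_lim (sadd x h)))
    (fun n v _ => value1 e r (jet_lim x n v)) (exp (l1_norm x + 1)) 1.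
Proof.
  intros Hx; constructor; unfold Rball.
  - intros n; split.
    + intros v w Hvw; now rewrite (jet_lim_ext x n v w).
    + intros v i y z a b t Hi Hv Hy Hz.
      rewrite jet_lim_linear, value1_padd, !value1_pscal
        by auto using pl1_pscal, jet_lim_pl1, l1_upd; ring.
  - intros n v Hv; apply Rabs_value1_le; now apply jet_lim_bound_1.
  - intros h N Hh H1.
    destruct (value1_psum e r N (fun n => jet_lim x n (fun _ => h))) as [P1 P2];
      [intros; now apply jet_lim_pl1|].
    rewrite <- P2, <- value1_psub by auto using nlf_lim_pl1, l1_sadd.
    apply Rabs_value1_le; now apply jet_lim_tail_1.
Qed.

Lemma geometric_sqr (f : seqZ -> R) A (K : R) :
  0 <= K -> geometric Rball (fun h _ => f h) A K 1 ->
  geometric Rball (fun h _ => f h ^ 2) (cauchy_prod A A) (2 * (K * K)) (2 * 1).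
Proof.
  intros HK H; apply (geometric_ext _ (fun h _ => f h * f h)); [intros; ring|].
  apply (geometric_mult Rball is_ball_Rball (fun h _ => f h) (fun h _ => f h)); auto; [lra|].
  apply (geometric_mono Rball is_ball_Rball _ _ K 1); auto; lra.
Qed.

Lemma geometric_value1_sqr (x : seqZ) :
  l1 x -> exists (Q : nat -> (nat -> seqZ) -> unit -> R) (K : R),
    0 <= K /\ geometric Rball (fun h _ => value1_sqr (nlf_lim (sadd x h))) Q K 2.
Proof.
  intros Hx; set (E := exp (l1_norm x + 1)); assert (HE : 0 <= E) by (left; apply exp_pos).
  assert (H := fun e r => geometric_sqr _ _ E HE (geometric_value1 x e r Hx)).
  replace (2 * 1) with 2 in H by ring.
  assert (H2 := geometric_plus Rball is_ball_Rball _ _ _ _ _ _ _ (H true true) (H true false)).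
  assert (H3 := geometric_plus Rball is_ball_Rball _ _ _ _ _ _ _ H2 (H false true)).
  assert (H4 := geometric_plus Rball is_ball_Rball _ _ _ _ _ _ _ H3 (H false false)).
  do 2 eexists; split; [|exact H4]; nra.
Qed.

Lemma l1_zero : l1 (fun _ => RtoC 0).
Proof. exact (proj1 l1le_zero). Qed.

Lemma l1_norm_zero : l1_norm (fun _ => RtoC 0) = 0.
Proof.
  apply Rle_antisym; [exact (proj2 l1le_zero) | apply l1_norm_ge0, l1_zero].
Qed.

(** At [h = 0] the remainder after one term is bounded by zero. *)
Lemma geometric_constant_term (f : seqZ -> R) A (K D : R) (v : nat -> seqZ) :
  geometric Rball (fun h _ => f h) A K D -> A O v tt = f (fun _ => RtoC 0).
Proof.
  intros [H1 _ H3]; set (o := fun _ : Z => RtoC 0).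
  assert (H := H3 o 1%nat l1_zero); unfold Rball in H; unfold o in H at 1 4.
  rewrite l1_norm_zero, Rmult_0_r in H; specialize (H ltac:(lra)); cbn [rsum] in H.
  rewrite (proj1 (H1 O) v (fun _ => o)) by (intros; lia).
  rewrite pow_1, Rmult_0_r, Rplus_0_l in H; pose proof (Rabs_pos (f o - A O (fun _ => o) tt)) as Hp.
  assert (E : Rabs (f o - A O (fun _ => o) tt) = 0) by lra.
  apply Rabs_eq_0 in E; fold o; lra.
Qed.

Lemma geometric_minus_one (f : seqZ -> R) A (K D : R) :
  0 <= K -> 0 <= D -> f (fun _ => RtoC 0) = 1 ->
  geometric Rball (fun h _ => f h) A K D ->
  geometric Rball (fun h _ => f h - 1) (fun n v t => if Nat.eqb n 0 then 0 else A n v t) (K + 1) D.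
Proof.
  intros HK HD Hf HA; pose proof (fun v => geometric_constant_term f A K D v HA) as H0.
  destruct HA as [H1 H2 H3]; rewrite Hf in H0; unfold Rball in *; constructor.
  - intros [|n]; cbn [Nat.eqb]; [|apply H1]; split; [reflexivity|]; intros; ring.
  - intros n v Hv; unfold Rball; assert (Hp : 0 <= prod_norms n v)
      by (apply prod_norms_ge0; intros; now apply l1_norm_ge0).
    assert (HDn : 0 <= D ^ n) by now apply pow_le.
    assert (0 <= D ^ n * prod_norms n v) by now apply Rmult_le_pos.
    destruct n as [|n]; cbn [Nat.eqb].
    + rewrite Rabs_R0; nra.
    + eapply Rle_trans; [now apply H2|]; nra.
  - intros h N Hh Hr; unfold Rball.
    assert (HN : 0 <= (D * l1_norm h) ^ N)
      by (apply pow_le, Rmult_le_pos; auto; now apply l1_norm_ge0).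
    specialize (H3 h N Hh Hr); destruct N as [|N].
    + simpl in *; rewrite Rminus_0_r in *.
      eapply Rle_trans; [apply Rabs_triang|]; rewrite Rabs_Ropp, Rabs_R1; lra.
    + replace (f h - 1 - _) with (f h - rsum (S N) (fun n => A n (fun _ => h) tt)); [nra|].
      assert (E : rsum (S N) (fun n => A n (fun _ => h) tt) =
        1 + rsum (S N) (fun n => if Nat.eqb n 0 then 0 else A n (fun _ => h) tt)); [|lra].
      clear - H0; induction N as [|N IH]; [cbn; rewrite H0; ring|].
      change (rsum (S N) (fun n => A n (fun _ => h) tt) + A (S N) (fun _ => h) tt =
        1 + (rsum (S N) (fun n => if Nat.eqb n 0 then 0 else A n (fun _ => h) tt) + A (S N) (fun _ => h) tt)).
      rewrite IH; ring.
Qed.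

Lemma sadd_zero_r (x : seqZ) : sadd x (fun _ => RtoC 0) = x.
Proof. apply functional_extensionality; intros k; unfold sadd; ring. Qed.

(** With [q0] the value of [q] at the centre, [q / q0 = 1 + w] where [w] has no constant term, so
    the composition with the binomial series applies; the factor [q0^(-1/2)] is restored at the
    end. *)
Lemma geometric_scale (x : seqZ) :
  l1 x -> exists (P : nat -> (nat -> seqZ) -> unit -> R) (K D : R),
    0 <= K /\ 1 <= D /\ geometric Rball (fun h _ => scale (sadd x h)) P K D.
Proof.
  intros Hx; destruct (geometric_value1_sqr x Hx) as (Q & K & HK & HQ).
  set (q0 := value1_sqr (nlf_lim x)); pose proof (value1_sqr_ge1 x Hx) as Hq0; fold q0 in Hq0.
  apply (geometric_scal Rball is_ball_Rball (/ q0)) in HQ.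
  set (K' := Rabs (/ q0) * K) in *.
  assert (HK' : 0 <= K') by (apply Rmult_le_pos; auto; apply Rabs_pos).
  apply geometric_minus_one in HQ; [|auto|lra|rewrite sadd_zero_r; fold q0; field; lra].
  apply geometric_invsqrt in HQ; [|lra|lra|reflexivity].
  apply (geometric_scal Rball is_ball_Rball (/ sqrt q0)) in HQ.
  do 3 eexists; split; [|split; [|eapply geometric_ext; [|exact HQ]]].
  - apply Rmult_le_pos; [apply Rabs_pos | lra].
  - lra.
  - intros h t; cbn beta; unfold scale; rewrite <- Rinv_mult, <- sqrt_mult_alt by lra.
    do 2 f_equal; field; lra.
Qed.

Lemma real_analytic_nlfs : real_analytic_l1 nlfs.
Proof.
  intros x Hx; destruct (geometric_scale x Hx) as (P & K & D & HK & HD & HP).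
  set (E := exp (l1_norm x + 1)); assert (HE : 0 <= E) by (left; apply exp_pos).
  assert (HS : geometric Pball (fun h => coords (nlf_lim (sadd x h)))
                 (fun n v => coords (jet_lim x n v)) E (2 * D)).
  { apply (geometric_mono Pball is_ball_Pball _ _ E 1); try lra; now apply geometric_nlf. }
  pose proof (geometric_mult Pball is_ball_Pball _ _ _ _ K E D HK HE ltac:(lra) HP HS) as HG.
  set (A := cauchy_prod P (fun n v => coords (jet_lim x n v))) in HG.
  set (L := 2 * (K * E)) in HG; assert (HL : 0 <= L) by (unfold L; nra).
  apply (geometric_ext _ _ (fun h => coords (nlfs (sadd x h)))) in HG.
  2:{ intros h [[e r] k]; unfold nlfs; cbn [coords]; now rewrite entry_pscal, part_scal. }
  destruct HG as [G1 G2 G3].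
  (* The product has rate [2 * D]; half of the corresponding radius turns the majorant into
     [L * (1/2)^n]. *)
  exists (/ (4 * D)), (fun n v => of_coords (A n v)), (fun n => L * (2 * D) ^ n).
  split; [apply Rinv_0_lt_compat; lra|]; split; [|split].
  - intros n; split; [|split].
    + intros v w Hvw; now rewrite (proj1 (G1 n) v w Hvw).
    + intros v i y z a b Hi Hv Hy Hz; rewrite <- !of_coords_scal, <- of_coords_plus; f_equal.
      apply functional_extensionality; intros t; now apply (proj2 (G1 n)).
    + intros v Hv; exact (G2 n v Hv).
  - apply ex_series_ext with (fun n => L * (/ 2) ^ n).
    + intros n; rewrite Rmult_assoc, <- Rpow_mult_distr; do 2 f_equal; field; lra.
    + apply (ex_series_scal (K := R_AbsRing) (V := R_NormedModule)).
      apply ex_series_geom; rewrite Rabs_pos_eq; lra.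
  - intros h Hh Hr; set (th := 2 * D * l1_norm h).
    assert (Hth : 0 <= th <= / 2).
    { pose proof (l1_norm_ge0 h Hh); unfold th; split; [nra|].
      apply Rmult_le_reg_r with (/ (2 * D)); [apply Rinv_0_lt_compat; lra|].
      replace (2 * D * l1_norm h * / (2 * D)) with (l1_norm h) by (field; lra).
      replace (/ 2 * / (2 * D)) with (/ (4 * D)) by (field; lra); lra. }
    apply is_lim_seq_le_le with (fun _ => 0) (fun N => L * th ^ N).
    + intros N; assert (HN := G3 h N Hh ltac:(fold th; lra)); unfold Pball in HN.
      rewrite (of_coords_tail _ N (fun n => A n (fun _ => h))) in HN; fold th in HN.
      split; [|exact (proj2 HN)].
      destruct HN as [[H1 H2] _]; apply Rplus_le_le_0_compat; now apply l1_norm_ge0.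
    + apply is_lim_seq_const.
    + apply is_lim_seq_scal0, is_lim_seq_geom; rewrite Rabs_pos_eq; lra.
Qed.

(** * Lipschitz estimates *)

Lemma sqrt_1_sqr_bounds (x : R) :
  0 <= x -> 1 <= sqrt (1 + x ^ 2) /\ x <= sqrt (1 + x ^ 2) <= 1 + x ^ 2 / 2 /\
    sqrt (1 + x ^ 2) ^ 2 = 1 + x ^ 2.
Proof.
  intros Hx; pose proof (pow2_ge_0 x) as H2; repeat split.
  - rewrite <- sqrt_1 at 1; apply sqrt_le_1_alt; lra.
  - rewrite <- (sqrt_pow2 x) at 1 by auto; apply sqrt_le_1_alt; lra.
  - rewrite <- (sqrt_pow2 (1 + x ^ 2 / 2)) by lra; apply sqrt_le_1_alt; nra.
  - apply pow2_sqrt; lra.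
Qed.

(** With [a] and [b] the two square roots, [|a - b| (a + b) = |x - y| (x + y)] and [x + y <= a + b];
    inverting divides the difference by [a b >= 1]. *)
Lemma inv_sqrt_lipschitz (x y : R) :
  0 <= x -> 0 <= y -> Rabs (/ sqrt (1 + x ^ 2) - / sqrt (1 + y ^ 2)) <= Rabs (x - y).
Proof.
  intros Hx Hy; destruct (sqrt_1_sqr_bounds x Hx) as (Ha1 & [Ha2 _] & Ha3).
  destruct (sqrt_1_sqr_bounds y Hy) as (Hb1 & [Hb2 _] & Hb3).
  set (a := sqrt (1 + x ^ 2)) in *; set (b := sqrt (1 + y ^ 2)) in *.
  assert (Hab : Rabs (a - b) <= Rabs (x - y)).
  { assert (E : Rabs (a - b) * (a + b) = Rabs (x - y) * (x + y)).
    { rewrite <- (Rabs_pos_eq (a + b)), <- (Rabs_pos_eq (x + y)), <- !Rabs_mult by lra.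
      f_equal; nra. }
    apply Rmult_le_reg_r with (a + b); [lra|]; rewrite E.
    apply Rmult_le_compat_l; [apply Rabs_pos | lra]. }
  replace (/ a - / b) with (- ((a - b) * / (a * b))) by (field; lra).
  rewrite Rabs_Ropp, Rabs_mult, (Rabs_pos_eq (/ (a * b))) by (left; apply Rinv_0_lt_compat; nra).
  assert (H : / (a * b) <= 1) by (rewrite <- Rinv_1; apply Rinv_le_contravar; nra).
  pose proof (Rabs_pos (a - b)); nra.
Qed.

(** All factors lie in the interval from 0 to 1, so the variation of the product is at most the sum
    of the variations of the factors. *)
Lemma normalizer_lipschitz (F F' : seqZ) (m : nat) :
  Rabs (normalizer F m - normalizer F' m) <= mass (ssub F F') m.
Proof.
  induction m as [|m IH]; [unfold mass; simpl; rewrite Rminus_diag, Rabs_R0; lra|].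
  cbn [normalizer]; rewrite mass_S; change (ssub F F' (site m)) with (F (site m) - F' (site m))%C.
  set (u := F (site m)); set (u' := F' (site m)).
  destruct (sqrt_1_sqr_bounds (Cmod u) (Cmod_ge_0 u)) as (Ha & _).
  pose proof (normalizer_bounds F' m) as Hb.
  pose proof (inv_sqrt_lipschitz (Cmod u) (Cmod u') (Cmod_ge_0 u) (Cmod_ge_0 u')) as Hl.
  set (c := sqrt (1 + Cmod u ^ 2)) in *; set (c' := / sqrt (1 + Cmod u' ^ 2)) in *.
  assert (Hc : 0 < / c <= 1).
  { split; [apply Rinv_0_lt_compat; lra | rewrite <- Rinv_1; apply Rinv_le_contravar; lra]. }
  assert (Hu : Rabs (Cmod u - Cmod u') <= Cmod (u - u')).
  { pose proof (Cmod_triangle (u - u') u'); pose proof (Cmod_triangle (u' - u) u).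
    replace (u - u' + u')%C with u in * by ring; replace (u' - u + u)%C with u' in * by ring.
    replace (u' - u)%C with (- (u - u'))%C in * by ring; rewrite Cmod_opp in *.
    apply Rabs_le; lra. }
  replace (normalizer F m * / c - normalizer F' m * c') with
    ((normalizer F m - normalizer F' m) * / c + normalizer F' m * (/ c - c')) by ring.
  eapply Rle_trans; [apply Rabs_triang|]; rewrite !Rabs_mult.
  rewrite (Rabs_pos_eq (/ c)), (Rabs_pos_eq (normalizer F' m)) by lra.
  apply Rplus_le_compat.
  - pose proof (Rabs_pos (normalizer F m - normalizer F' m)); nra.
  - pose proof (Rabs_pos (/ c - c')); nra.
Qed.

(** The defects [1 - (1 + x^2)^(-1/2) <= x^2 / 2] of the factors add up, and the sum of the squares
    is at most the square of the sum. *)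
Lemma normalizer_ge (F : seqZ) (m : nat) : 1 - normalizer F m <= mass F m ^ 2 / 2.
Proof.
  induction m as [|m IH]; [unfold mass; simpl; lra|].
  cbn [normalizer]; rewrite mass_S; set (x := Cmod (F (site m))).
  assert (Hx : 0 <= x) by apply Cmod_ge_0; pose proof (mass_ge0 F m) as Hm.
  destruct (sqrt_1_sqr_bounds x Hx) as (Ha & [_ Hb] & _); pose proof (normalizer_bounds F m).
  set (c := sqrt (1 + x ^ 2)) in *.
  assert (Hc : 1 - / c <= x ^ 2 / 2).
  { assert (/ (1 + x ^ 2 / 2) <= / c) by (apply Rinv_le_contravar; lra).
    assert (1 - x ^ 2 / 2 <= / (1 + x ^ 2 / 2)); [|lra].
    pose proof (pow2_ge_0 x); apply Rmult_le_reg_r with (1 + x ^ 2 / 2); [lra|].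
    rewrite Rinv_l by lra; nra. }
  assert (0 < / c <= 1).
  { split; [apply Rinv_0_lt_compat; lra | rewrite <- Rinv_1; apply Rinv_le_contravar; lra]. }
  assert (normalizer F m * (1 - / c) <= x ^ 2 / 2) by nra.
  nra.
Qed.

(* The pair [(prod (1 + y j) + prod (1 - y j)) / 2], [(prod (1 + y j) - prod (1 - y j)) / 2] over
   [j < m]: it dominates the norms of [a] and [b] when [|F (site j)| <= y j], because each step
   exchanges the roles of [a] and [b]. *)
Fixpoint even_part (y : nat -> R) (m : nat) : R :=
  match m with
  | O => 1
  | S m' => even_part y m' + y m' * odd_part y m'
  end
with odd_part (y : nat -> R) (m : nat) : R :=
  match m with
  | O => 0
  | S m' => odd_part y m' + y m' * even_part y m'
  end.

Lemma even_odd_part_ge (y : nat -> R) (m : nat) :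
  (forall j, 0 <= y j) -> 1 <= even_part y m /\ 0 <= odd_part y m.
Proof.
  intros Hy; induction m as [|m [IH1 IH2]]; cbn [even_part odd_part]; [lra|].
  specialize (Hy m); split; nra.
Qed.

Lemma even_odd_part_exp (y : nat -> R) (m : nat) :
  (forall j, 0 <= y j) -> even_part y m + odd_part y m <= exp (rsum m y).
Proof.
  intros Hy; induction m as [|m IH]; cbn [even_part odd_part rsum]; [rewrite exp_0; lra|].
  eapply Rle_trans; [|apply exp_plus_ge]; specialize (Hy m); nra.
Qed.

Lemma fst_padd_l1le (p q : pseq) (K K' : R) :
  l1le (fst p) K -> l1le (fst q) K' -> l1le (fst (padd p q)) (K + K').
Proof. apply l1le_sadd. Qed.

Lemma snd_padd_l1le (p q : pseq) (K K' : R) :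
  l1le (snd p) K -> l1le (snd q) K' -> l1le (snd (padd p q)) (K + K').
Proof. apply l1le_sadd. Qed.

(** The third bound gains the 1 that the identity contributes to the even part; this gain is what
    removes the linear term from the variation of [b]. *)
Lemma nlf_parts (F : seqZ) (y : nat -> R) (m : nat) :
  (forall j, Cmod (F (site j)) <= y j) ->
  l1le (fst (nlf F m)) (even_part y m) /\ l1le (snd (nlf F m)) (odd_part y m) /\
  l1le (fst (psub (nlf F m) pone)) (even_part y m - 1).
Proof.
  intros Hy.
  assert (Hy0 : forall j, 0 <= y j) by (intros j; eapply Rle_trans; [apply Cmod_ge_0 | apply Hy]).
  induction m as [|m (IH1 & IH2 & IH3)].
  - cbn [even_part odd_part]; change (nlf F 0) with pone; split; [|split].
    + apply ple_fst, ple_pone.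
    + apply l1le_zero.
    + replace (psub pone pone) with pzero by pseq_ring; replace (1 - 1) with 0 by ring.
      apply l1le_zero.
  - rewrite nlf_S; cbn [even_part odd_part]; specialize (Hy m).
    destruct (even_odd_part_ge y m Hy0) as [He Ho].
    assert (H1 := step_fst_l1le m (F (site m)) _ _ IH2).
    assert (H2 := step_snd_l1le m (F (site m)) _ _ IH1).
    split; [|split].
    + apply (l1le_mono _ (even_part y m + Cmod (F (site m)) * odd_part y m));
        [now apply fst_padd_l1le | nra].
    + apply (l1le_mono _ (odd_part y m + Cmod (F (site m)) * even_part y m));
        [now apply snd_padd_l1le | nra].
    + replace (psub (padd (nlf F m) (step m (F (site m)) (nlf F m))) pone) with
        (padd (psub (nlf F m) pone) (step m (F (site m)) (nlf F m))) by pseq_ring.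
      apply (l1le_mono _ (even_part y m - 1 + Cmod (F (site m)) * odd_part y m));
        [now apply fst_padd_l1le | nra].
Qed.

(** The term of degree one of the unnormalised product around zero; its second entry is [H] cut off
    to the first [m] sites. *)
Fixpoint linear_part (H : seqZ) (m : nat) : pseq :=
  match m with
  | O => pzero
  | S m' => padd (linear_part H m') (step m' (H (site m')) pone)
  end.

Lemma nlf_difference (F F' : seqZ) (y : nat -> R) (m : nat) :
  (forall j, Cmod (F (site j)) <= y j) -> (forall j, Cmod (F' (site j)) <= y j) ->
  let d := mass (ssub F F') m in
  l1le (fst (psub (nlf F m) (nlf F' m))) (d * odd_part y m) /\
  l1le (snd (psub (nlf F m) (nlf F' m))) (d * even_part y m) /\
  l1le (snd (psub (psub (nlf F m) (nlf F' m)) (linear_part (ssub F F') m))) (d * (even_part y m - 1)).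
Proof.
  intros Hy Hy'; cbv zeta.
  assert (Hy0 : forall j, 0 <= y j) by (intros j; eapply Rle_trans; [apply Cmod_ge_0 | apply Hy]).
  induction m as [|m (IH1 & IH2 & IH3)].
  - change (nlf F 0) with pone; change (nlf F' 0) with pone; unfold mass; cbn [rsum linear_part].
    rewrite !Rmult_0_l; replace (psub pone pone) with pzero by pseq_ring.
    replace (psub pzero pzero) with pzero by pseq_ring; split; [|split]; apply l1le_zero.
  - rewrite !nlf_S, mass_S; cbn [even_part odd_part linear_part].
    change (ssub F F' (site m)) with (F (site m) - F' (site m))%C.
    destruct (nlf_parts F' y m Hy') as (N1 & N2 & N3).
    destruct (even_odd_part_ge y m Hy0) as [He Ho]; specialize (Hy m).
    set (u := F (site m)) in *; set (u' := F' (site m)) in *.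
    set (s := nlf F m) in *; set (s' := nlf F' m) in *; set (l := linear_part (ssub F F') m) in *.
    set (d := mass (ssub F F') m) in *; set (x := Cmod (u - u')).
    assert (Hd : 0 <= d) by apply mass_ge0; assert (Hx : 0 <= x) by apply Cmod_ge_0.
    pose proof (Cmod_ge_0 u) as Hu; pose proof (Hy0 m) as Hym.
    set (e := even_part y m) in *; set (o := odd_part y m) in *.
    assert (Hde : 0 <= d * e) by nra; assert (Hdo : 0 <= d * o) by nra.
    (* Product rule: either the earlier difference passes through the step with [u], or the change
       [u - u'] acts on the earlier row of [F']. *)
    replace (psub (padd s (step m u s)) (padd s' (step m u' s'))) with
      (padd (padd (psub s s') (step m u (psub s s'))) (step m (u - u') s'))
      by (rewrite step_psub, step_minus_l; pseq_ring).
    split; [|split].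
    + eapply l1le_mono.
      * apply fst_padd_l1le; [apply fst_padd_l1le; [exact IH1 | apply step_fst_l1le; exact IH2]|].
        apply step_fst_l1le; exact N2.
      * fold x; assert (Cmod u * (d * e) <= y m * (d * e)) by (apply Rmult_le_compat_r; lra).
        assert (0 <= x * (y m * e)) by (repeat apply Rmult_le_pos; lra); lra.
    + eapply l1le_mono.
      * apply snd_padd_l1le; [apply snd_padd_l1le; [exact IH2 | apply step_snd_l1le; exact IH1]|].
        apply step_snd_l1le; exact N1.
      * fold x; assert (Cmod u * (d * o) <= y m * (d * o)) by (apply Rmult_le_compat_r; lra).
        assert (0 <= x * (y m * o)) by (repeat apply Rmult_le_pos; lra); lra.
    + replace (psub _ (padd l (step m (u - u') pone))) with
        (* Subtracting the linear term replaces [s'] by [s' - 1] in the last step, whose first entry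
           has norm at most the even part minus 1. *)
        (padd (padd (psub (psub s s') l) (step m u (psub s s'))) (step m (u - u') (psub s' pone)))
        by (rewrite (step_psub m (u - u')); pseq_ring).
      eapply l1le_mono.
      * apply snd_padd_l1le; [apply snd_padd_l1le; [exact IH3 | apply step_snd_l1le; exact IH1]|].
        apply step_snd_l1le; exact N3.
      * fold x; assert (Cmod u * (d * o) <= y m * (d * o)) by (apply Rmult_le_compat_r; lra).
        assert (0 <= x * (y m * o)) by (repeat apply Rmult_le_pos; lra); lra.
Qed.

Lemma snd_linear_part_l1le (H : seqZ) (m : nat) : l1le (snd (linear_part H m)) (mass H m).
Proof.
  induction m as [|m IH]; [apply l1le_zero|].
  cbn [linear_part]; rewrite mass_S, <- (Rmult_1_r (Cmod (H (site m)))).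
  apply snd_padd_l1le; auto; apply step_snd_l1le, ple_fst, ple_pone.
Qed.

Lemma site_surj (k : Z) : exists j, site j = k.
Proof.
  destruct (Z_halves k) as [n [-> | ->]]; [exists (2 * n)%nat | exists (S (2 * n))];
    [apply site_double | apply site_double_S].
Qed.

Lemma snd_step_pone (m : nat) (u : C) (k : Z) :
  snd (step m u pone) k = if Z.eqb k (site m) then u else RtoC 0.
Proof.
  unfold step, pone; destruct (Nat.even m); cbn [fst snd].
  - destruct (Z.eqb_spec (k - site m) 0), (Z.eqb_spec k (site m)); try lia; ring.
  - destruct (Z.eqb_spec (site m - k) 0), (Z.eqb_spec k (site m)); try lia;
      rewrite Cconj_RtoC; ring.
Qed.

Lemma snd_linear_part (H : seqZ) (m j : nat) :
  snd (linear_part H m) (site j) = if Nat.ltb j m then H (site j) else RtoC 0.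
Proof.
  induction m as [|m IH]; [reflexivity|].
  change (snd (linear_part H m) (site j) + snd (step m (H (site m)) pone) (site j) =
    if Nat.ltb j (S m) then H (site j) else RtoC 0)%C.
  rewrite IH, snd_step_pone.
  destruct (Nat.ltb_spec j m), (Nat.ltb_spec j (S m)), (Z.eqb_spec (site j) (site m)) as [E|E];
    try lia; try ring.
  - apply site_inj in E; lia.
  - rewrite E; ring.
  - replace j with m in E by lia; congruence.
  - apply site_inj in E; lia.
Qed.

(** The coordinate at [site j] equals [H] there as soon as [m] exceeds [j], which identifies the
    limit. *)
Lemma linear_part_conv (H : seqZ) :
  l1 H -> exists l, pconv (linear_part H) l /\ snd l = H.
Proof.
  intros HH.
  assert (Hc : pconv (linear_part H) (plim (linear_part H))).
  { apply pconv_plim with (fun m => Cmod (H (site m)) * 1); [|apply ex_series_scal_r; now apply ex_series_site].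
    intros m; cbn [linear_part].
    replace (psub _ _) with (step m (H (site m)) pone) by pseq_ring.
    apply ple_step, ple_pone. }
  exists (plim (linear_part H)); split; auto.
  destruct Hc as (tau & Ht & Hl); set (l := plim (linear_part H)) in *.
  apply functional_extensionality; intros k; destruct (site_surj k) as [j <-].
  assert (E : Cmod (snd l (site j) - H (site j)) <= 0).
  { apply (le_of_is_lim_seq0 _ _ (fun m => tau (m + S j)%nat)); [now apply is_lim_seq_incr_n|].
    intros m; rewrite Rplus_0_l.
    pose proof (l1le_Cmod _ _ (site j) (ple_snd _ _ (Hl (m + S j)%nat))) as Hk.
    unfold psub, ssub in Hk; cbn [snd] in Hk; rewrite snd_linear_part in Hk.
    destruct (Nat.ltb_spec j (m + S j)); [exact Hk | lia]. }
  assert (E0 : (snd l (site j) - H (site j) = 0)%C).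
  { apply Cmod_eq_0; pose proof (Cmod_ge_0 (snd l (site j) - H (site j))); lra. }
  replace (snd l (site j)) with (snd l (site j) - H (site j) + H (site j))%C by ring.
  rewrite E0; ring.
Qed.

Lemma pconv_snd_l1le (u : nat -> pseq) (l : pseq) (K : R) :
  pconv u l -> (forall m, l1le (snd (u m)) K) -> l1le (snd l) K.
Proof.
  intros (tau & Ht & H) Hu; apply (l1le_limit (fun m => snd (u m)) _ tau); auto.
  - intros m; apply l1le_mono with K; auto; pose proof (ple_ge0 _ _ (H m)); lra.
  - intros m; exact (ple_snd _ _ (H m)).
Qed.

Lemma nlfs_conv (F : seqZ) :
  l1 F -> pconv (fun m => pscal (normalizer F m) (nlf F m)) (nlfs F).
Proof.
  intros HF; destruct (nlf_conv F HF) as (tau & Ht & H).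
  set (K := exp (l1_norm F) * prod_norms 0 (fun _ => F)).
  exists (fun m => Rabs (scale F) * tau m + Rabs (normalizer F m - scale F) * K); split.
  - apply is_lim_seq_plus0; [now apply is_lim_seq_scal0|].
    apply is_lim_seq_ext with (fun m => K * Rabs (normalizer F m - scale F)); [intros; ring|].
    apply is_lim_seq_scal0, (proj1 (is_lim_seq_abs_0 _)).
    replace (Finite 0) with (Finite (scale F - scale F)) by (f_equal; ring).
    apply is_lim_seq_minus'; [now apply normalizer_lim | apply is_lim_seq_const].
  - intros m; unfold nlfs; rewrite Rabs_minus_sym.
    replace (psub _ _) with (padd (pscal (scale F) (psub (nlf_lim F) (nlf F m)))
      (pscal (scale F - normalizer F m) (nlf F m))).
    + apply ple_padd; apply ple_pscal; [apply H | now apply jet_ple_l1].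
    + apply pseq_ext; intros k; unfold padd, psub, pscal, sadd, ssub, sscal; cbn [fst snd];
        rewrite RtoC_minus; ring.
Qed.

Lemma mass_le_l1le (F : seqZ) (K : R) (m : nat) : l1le F K -> mass F m <= K.
Proof. intros [H1 H2]; eapply Rle_trans; [now apply mass_le_l1_norm | exact H2]. Qed.

Lemma snd_pscal_l1le (c : R) (p : pseq) (K K' : R) :
  l1le (snd p) K -> Rabs c <= K' -> l1le (snd (pscal c p)) (K' * K).
Proof.
  intros Hp Hc; apply l1le_mono with (Rabs c * K); [now apply l1le_sscal|].
  apply Rmult_le_compat_r; auto; now apply l1le_ge0 with (snd p).
Qed.

(** In the first bound the variation of the unnormalised [b] contributes the even part and that of
    the normalisation the odd part; their sum is at most the exponential. The second bound loses the
    1 of the linear term and pays the defect of the normalisation on that term. *)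
Lemma nlfs_local_estimates (F F' : seqZ) (r d : R) :
  l1le F r -> l1le F' r -> l1le (ssub F F') d ->
  l1le (ssub (snd (nlfs F)) (snd (nlfs F'))) (exp (r + d) * d) /\
  l1le (ssub (ssub (snd (nlfs F)) (snd (nlfs F'))) (ssub F F'))
    ((exp (r + d) - 1 + (r + d) ^ 2 / 2) * d).
Proof.
  intros HF HF' Hd.
  (* This dominates both sequences and has sum at most [r + d]. *)
  set (y := fun j => Cmod (F (site j)) + Cmod (ssub F F' (site j))).
  assert (Hy0 : forall j, 0 <= y j) by (intros; apply Rplus_le_le_0_compat; apply Cmod_ge_0).
  assert (Hy : forall j, Cmod (F (site j)) <= y j).
  { intros j; unfold y; pose proof (Cmod_ge_0 (ssub F F' (site j))); lra. }
  assert (Hy' : forall j, Cmod (F' (site j)) <= y j).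
  { intros j; unfold y, ssub; rewrite <- (Cmod_opp (F (site j) - F' (site j))).
    eapply Rle_trans; [|apply Cmod_triangle]; right; f_equal; ring. }
  assert (Hexp : forall m, even_part y m + odd_part y m <= exp (r + d)).
  { intros m; eapply Rle_trans; [now apply even_odd_part_exp|]; apply exp_mono.
    unfold y; rewrite rsum_plus; apply Rplus_le_compat;
      [exact (mass_le_l1le F r m HF) | exact (mass_le_l1le _ d m Hd)]. }
  set (g := fun m => psub (pscal (normalizer F m) (nlf F m)) (pscal (normalizer F' m) (nlf F' m))).
  assert (Eg : forall m, g m = padd (pscal (normalizer F m) (psub (nlf F m) (nlf F' m)))
      (pscal (normalizer F m - normalizer F' m) (nlf F' m))).
  { intros m; apply pseq_ext; intros k; unfold g, padd, psub, pscal, sadd, ssub, sscal; cbn [fst snd];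
      rewrite RtoC_minus; ring. }
  assert (Cg : pconv g (psub (nlfs F) (nlfs F')))
    by (apply pconv_psub; apply nlfs_conv; [apply HF | apply HF']).
  assert (Hr0 := l1le_ge0 _ _ HF); assert (Hd0 := l1le_ge0 _ _ Hd).
  split.
  - apply (pconv_snd_l1le _ (psub (nlfs F) (nlfs F')) _ Cg); intros m; rewrite Eg.
    destruct (nlf_difference F F' y m Hy Hy') as (_ & D2 & _).
    destruct (nlf_parts F' y m Hy') as (_ & N2 & _).
    destruct (even_odd_part_ge y m Hy0) as [He Ho].
    pose proof (normalizer_bounds F m) as Hp; pose proof (normalizer_lipschitz F F' m) as Hl.
    pose proof (mass_le_l1le _ d m Hd) as Hm; pose proof (mass_ge0 (ssub F F') m).
    eapply l1le_mono.
    + apply snd_padd_l1le; [apply (snd_pscal_l1le _ _ _ 1 D2); rewrite Rabs_pos_eq; lra|].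
      apply (snd_pscal_l1le _ _ _ _ N2 Hl).
    + specialize (Hexp m); nra.
  - destruct (linear_part_conv (ssub F F') (proj1 Hd)) as (l & Cl & El).
    replace (ssub (ssub (snd (nlfs F)) (snd (nlfs F'))) (ssub F F')) with
      (snd (psub (psub (nlfs F) (nlfs F')) l)) by (unfold psub; cbn [snd]; now rewrite El).
    apply (pconv_snd_l1le _ _ _ (pconv_psub _ _ _ _ Cg Cl)).
    intros m; rewrite Eg.
    destruct (nlf_difference F F' y m Hy Hy') as (_ & _ & D3).
    destruct (nlf_parts F' y m Hy') as (_ & N2 & _).
    destruct (even_odd_part_ge y m Hy0) as [He Ho].
    pose proof (normalizer_bounds F m) as Hp; pose proof (normalizer_lipschitz F F' m) as Hl.
    pose proof (normalizer_ge F m) as Hg.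
    pose proof (mass_le_l1le _ d m Hd) as Hm; pose proof (mass_ge0 (ssub F F') m) as Hm0.
    pose proof (mass_le_l1le _ r m HF) as Hr; pose proof (mass_ge0 F m) as Hr1.
    set (p := normalizer F m) in *; set (L := linear_part (ssub F F') m) in *.
    (* With [b], [b'] unnormalised and [p], [p'] the normalisations: [p b - p' b' - L = p (b - b' -
       L) + (p - 1) L + (p - p') b']. *)
    replace (psub _ _) with (padd (padd (pscal p (psub (psub (nlf F m) (nlf F' m)) L))
      (pscal (p - 1) L)) (pscal (p - normalizer F' m) (nlf F' m))).
    2:{ apply pseq_ext; intros k; unfold padd, psub, pscal, sadd, ssub, sscal; cbn [fst snd];
          rewrite !RtoC_minus; ring. }
    eapply l1le_mono.
    + apply snd_padd_l1le; [apply snd_padd_l1le|].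
      * apply (snd_pscal_l1le _ _ _ 1 D3); rewrite Rabs_pos_eq; lra.
      * apply (snd_pscal_l1le _ _ _ ((r + d) ^ 2 / 2) (snd_linear_part_l1le _ _)).
        rewrite Rabs_left1 by lra; nra.
      * apply (snd_pscal_l1le _ _ _ _ N2 Hl).
    + specialize (Hexp m); set (M := mass (ssub F F') m) in *.
      set (S := (r + d) ^ 2 / 2); assert (HS : 0 <= S) by (unfold S; nra).
      apply Rle_trans with ((even_part y m + odd_part y m - 1 + S) * M); [right; ring|].
      apply Rmult_le_compat; lra.
Qed.

Definition segment (F F' : seqZ) (t : R) : seqZ := sadd (sscal (1 - t) F) (sscal t F').

Lemma segment_l1le (F F' : seqZ) (r t : R) :
  0 <= t <= 1 -> l1le F r -> l1le F' r -> l1le (segment F F' t) r.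
Proof.
  intros Ht HF HF'; replace r with (Rabs (1 - t) * r + Rabs t * r)
    by (rewrite !Rabs_pos_eq by lra; ring).
  apply l1le_sadd; now apply l1le_sscal.
Qed.

(* The increments along a subdivided segment stay in the ball of radius [r], so that the loss [d]
   in the local constant disappears in the limit of fine subdivisions. *)
Lemma lipschitz_of_local (Phi : seqZ -> seqZ) (g : R -> R) (r d : R) (F F' : seqZ) :
  continuity_pt g r ->
  (forall F F' d, l1le F r -> l1le F' r -> l1le (ssub F F') d ->
     l1le (ssub (Phi F) (Phi F')) (g (r + d) * d)) ->
  l1le F r -> l1le F' r -> l1le (ssub F F') d ->
  l1le (ssub (Phi F) (Phi F')) (g r * d).
Proof.
  intros Hg Hloc HF HF' Hd.
  (* The segment is cut into [S n] equal pieces of length at most [d / S n]; adding the local bounds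
     restores the factor [d] while the argument of [g] exceeds [r] only by one piece. *)
  assert (Hn : forall n, l1le (ssub (Phi F) (Phi F')) (g (r + d * / INR (S n)) * d)).
  { intros n; set (N := INR (S n)); assert (HN : 0 < N) by (apply lt_0_INR; lia).
    assert (Hi : forall i, (i <= S n)%nat ->
      l1le (ssub (Phi F) (Phi (segment F F' (INR i * / N)))) (INR i * (g (r + d * / N) * (d * / N)))).
    { assert (Ht : forall i, (i <= S n)%nat -> 0 <= INR i * / N <= 1).
      { intros i Hi; apply le_INR in Hi; fold N in Hi; pose proof (pos_INR i).
        split; [apply Rmult_le_pos; auto; left; now apply Rinv_0_lt_compat|].
        apply (Rle_div_l (INR i) 1 N); auto; lra. }
      induction i as [|i IH]; intros Hi.
      - replace (segment F F' (INR 0 * / N)) with F.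
        + simpl INR; rewrite Rmult_0_l.
          replace (ssub (Phi F) (Phi F)) with (fun _ : Z => RtoC 0); [apply l1le_zero|].
          apply functional_extensionality; intros k; unfold ssub; ring.
        + apply functional_extensionality; intros k; unfold segment, sadd, sscal; simpl INR.
          rewrite Rmult_0_l, Rminus_0_r; ring.
      - set (G := segment F F' (INR i * / N)) in *; set (G' := segment F F' (INR (S i) * / N)).
        assert (HG : l1le (ssub (Phi G) (Phi G')) (g (r + d * / N) * (d * / N))).
        { apply Hloc; [apply segment_l1le; auto; apply Ht; lia | apply segment_l1le; auto|].
          replace (ssub G G') with (sscal (/ N) (ssub F F')).
          - apply l1le_mono with (Rabs (/ N) * d); [now apply l1le_sscal|].
            rewrite Rabs_pos_eq by (left; now apply Rinv_0_lt_compat); lra.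
          - apply functional_extensionality; intros k; unfold G, G', segment, ssub, sadd, sscal.
            rewrite S_INR, !RtoC_minus, !RtoC_mult, RtoC_plus; ring. }
        rewrite S_INR, Rmult_plus_distr_r, Rmult_1_l.
        apply (l1le_add _ _ _ _ _ (IH ltac:(lia)) HG); intros k; unfold ssub.
        eapply Rle_trans; [|apply Cmod_triangle]; right; f_equal; ring. }
    specialize (Hi (S n) (le_n _)); fold N in Hi; rewrite Rinv_r in Hi by lra.
    replace (segment F F' 1) with F' in Hi.
    - replace (g (r + d * / N) * d) with (N * (g (r + d * / N) * (d * / N))) by (field; lra).
      exact Hi.
    - apply functional_extensionality; intros k; unfold segment, sadd, sscal.
      rewrite Rminus_diag; ring. }
  split; [exact (proj1 (Hn O))|].
  apply (is_lim_seq_le (fun _ => l1_norm (ssub (Phi F) (Phi F')))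
    (fun n => g (r + d * / INR (S n)) * d) (l1_norm (ssub (Phi F) (Phi F'))) (g r * d)).
  - intros n; exact (proj2 (Hn n)).
  - apply is_lim_seq_const.
  - apply is_lim_seq_mult'; [|apply is_lim_seq_const].
    apply (is_lim_seq_continuous g); auto.
    replace (Finite r) with (Finite (r + 0)) by (f_equal; ring).
    apply is_lim_seq_plus'; [apply is_lim_seq_const|].
    apply is_lim_seq_scal0; apply (is_lim_seq_incr_1 (fun n => / INR n)).
    apply (is_lim_seq_inv INR p_infty); [apply is_lim_seq_INR | easy].
Qed.

Lemma pow_exp (x : R) (n : nat) : exp x ^ n = exp (INR n * x).
Proof.
  induction n as [|n IH]; [simpl; now rewrite Rmult_0_l, exp_0|].
  rewrite S_INR, Rmult_plus_distr_r, Rmult_1_l, exp_plus, <- IH; simpl; ring.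
Qed.

(** The inequality [1 + x <= exp x] at [x = - 1 / 200], raised to the powers 8 and then 9, bounds
    [exp (- 0.36)] from below since [72 / 200 = 0.36]; inversion gives the upper bound. *)
Lemma exp_036 : exp (36 / 100) <= 1435 / 1000.
Proof.
  assert (H1 : 199 / 200 <= exp (- (1 / 200))).
  { eapply Rle_trans; [|apply exp_ineq1_le]; lra. }
  assert (H2 : 96069 / 100000 <= exp (- (1 / 25))).
  { replace (- (1 / 25)) with (INR 8 * - (1 / 200)) by (rewrite INR_IZR_INZ; simpl IZR; field).
    rewrite <- pow_exp; apply Rle_trans with ((199 / 200) ^ 8); [lra | apply pow_incr; lra]. }
  assert (H3 : 1000 / 1435 <= exp (- (36 / 100))).
  { replace (- (36 / 100)) with (INR 9 * - (1 / 25)) by (rewrite INR_IZR_INZ; simpl IZR; field).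
    rewrite <- pow_exp; apply Rle_trans with ((96069 / 100000) ^ 9); [lra | apply pow_incr; lra]. }
  rewrite exp_Ropp in H3; apply Rinv_le_contravar in H3; [|lra].
  rewrite Rinv_inv in H3; lra.
Qed.

Theorem theorem5p2 :
  exists G : seqZ -> pseq,
    (* G extends the nonlinear Fourier series of finitely supported sequences:
       its output is the pair of Fourier coefficient sequences of (a, b) *)
    (forall (F : seqZ) (N : nat), finitely_supported_in F N ->
       forall z : C, Cmod z = 1 ->
         Zseries_to (fst (G F)) z (fst (nlfs_fin F N z)) /\
         Zseries_to (snd (G F)) z (snd (nlfs_fin F N z))) /\
    (* G maps ℓ^1(Z) into A(T, C^2) *)
    (forall F : seqZ, l1 F -> pl1 (G F)) /\
    (* G is real analytic on ℓ^1(Z) *)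
    real_analytic_l1 G /\
    (* Lipschitz estimates for the second entry b *)
    (forall (R0 : R) (F F' : seqZ),
       0 <= R0 -> l1 F -> l1 F' -> l1_norm F <= R0 -> l1_norm F' <= R0 ->
       l1_norm (ssub (snd (G F)) (snd (G F'))) <= exp R0 * l1_norm (ssub F F') /\
       (R0 <= 36 / 100 -> l1_norm (ssub F F') <= 2 * l1_norm (ssub (snd (G F)) (snd (G F'))))).
Proof.
  exists nlfs; split; [|split; [|split]].
  - intros F N HF z Hz; now apply nlfs_finitely_supported.
  - exact nlfs_pl1.
  - exact real_analytic_nlfs.
  - intros r F F' Hr0 HF HF' Hr Hr'.
    assert (H1 : l1le F r) by (split; auto); assert (H2 : l1le F' r) by (split; auto).
    set (d := l1_norm (ssub F F')).
    assert (Hd : l1le (ssub F F') d) by (apply l1le_norm; now apply l1_ssub).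
    split.
    + apply (lipschitz_of_local (fun F => snd (nlfs F)) exp r d F F'); auto.
      * apply derivable_continuous_pt, derivable_pt_exp.
      * intros G G' e HG HG' He; exact (proj1 (nlfs_local_estimates _ _ _ _ HG HG' He)).
    + intros Hr36; set (b := snd (nlfs F)); set (b' := snd (nlfs F')).
      set (g := fun t => exp t - 1 + t ^ 2 / 2).
      (* The passage from local to global is applied to the nonlinear part [b - F]. *)
      assert (Hb : l1le (ssub (ssub b F) (ssub b' F')) (g r * d)).
      { apply (lipschitz_of_local (fun F => ssub (snd (nlfs F)) F) g r d F F'); auto.
        - apply derivable_continuous_pt; unfold g; reg.
        - intros G G' e HG HG' He.
          replace (ssub (ssub (snd (nlfs G)) G) (ssub (snd (nlfs G')) G')) with
            (ssub (ssub (snd (nlfs G)) (snd (nlfs G'))) (ssub G G'))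
            by (apply functional_extensionality; intros k; unfold ssub; ring).
          exact (proj2 (nlfs_local_estimates _ _ _ _ HG HG' He)). }
      (* At [0.36] the value is at most [0.435 + 0.0648 = 0.4998]. *)
      assert (Hg : g r <= / 2).
      { unfold g; pose proof (exp_mono r (36 / 100) Hr36); pose proof exp_036; nra. }
      assert (Hbb : l1 (ssub b b')) by (apply l1_ssub; apply nlfs_pl1; auto).
      (* From [F - F' = (b - b') - ((b - F) - (b' - F'))] one gets [d <= |b - b'| + d / 2]. *)
      assert (Hs : l1le (ssub F F') (l1_norm (ssub b b') + g r * d)).
      { apply (l1le_add _ _ _ _ _ (l1le_norm _ Hbb) Hb); intros k; unfold ssub.
        rewrite <- (Cmod_opp (b k - F k - (b' k - F' k))).
        eapply Rle_trans; [|apply Cmod_triangle]; right; f_equal; ring. }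
      destruct Hs as [_ Hs]; fold d in Hs; pose proof (l1le_ge0 _ _ Hd); nra.
Qed.
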